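(* Let $\mathcal{H}$ be a separable complex Hilbert space, let $P,Q\in\mathcal{B}(\mathcal{H})$, let $\varphi$ be an Orlicz function and let $\alpha\in[0,1]$. If $A=\begin{bmatrix}O & P\\ Q & O\end{bmatrix}\in\mathcal{B}(\mathcal{H}\oplus\mathcal{H})$, then \begin{align*} \varphi(w^2(A))&\le \frac14\left\|\begin{bmatrix}\varphi(|Q|^2)+\varphi(|P^*|^2) & O\\ O & \varphi(|P|^2)+\varphi(|Q^*|^2)\end{bmatrix}\right\|\\ &\quad+\frac{\alpha}{2}\left\|\begin{bmatrix}\varphi(|\mathfrak{R}(|Q||P^*|)|) & O\\ O & \varphi(|\mathfrak{R}(|P||Q^*|)|)\end{bmatrix}\right\|\\ &\quad+\frac{1-\alpha}{2}\,\varphi\left(w\left(\begin{bmatrix}PQ & O\\ O & QP\end{bmatrix}\right)\right). \end{align*}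
   Context: $\mathcal{B}(\mathcal{H})$ is the algebra of bounded linear operators on $\mathcal{H}$, $\|\cdot\|$ is the operator norm, $O$ is the zero operator, $A^*$ is the adjoint, $|A|=(A^*A)^{1/2}$ and $\mathfrak{R}(A)=\frac12(A+A^* )$. The numerical radius of an operator $A$ on a Hilbert space $\mathcal{K}$ is $w(A)=\sup\{|\langle Ax,x\rangle| : x\in\mathcal{K},\ \|x\|=1\}$, and $w^2(A)=(w(A))^2$. An Orlicz function is a map $\varphi:[0,\infty)\to[0,\infty)$ that is convex, continuous, non-decreasing, with $\varphi(0)=0$, $\varphi(u)>0$ for $u>0$, and $\varphi(u)\to\infty$ as $u\to\infty$. For a positive operator $T$, $\varphi(T)$ is defined by continuous functional calculus. $2\times2$ operator matrices act on $\mathcal{H}\oplus\mathcal{H}$ in the usual way. *)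

(* Defs.v *)
From HB Require Import structures.
From mathcomp Require Import all_boot all_order all_algebra.
From mathcomp Require Import sesquilinear complex ring.
From mathcomp Require Import all_classical all_reals all_analysis.

Set Implicit Arguments.
Unset Strict Implicit.
Unset Printing Implicit Defensive.

Import Order.TTheory GRing.Theory Num.Theory.
Import numFieldNormedType.Exports.

Local Open Scope classical_set_scope.
Local Open Scope ring_scope.
Local Open Scope complex_scope.

(* The inner product is linear in its first argument.  The norm of a normed
   module over R[i] takes its values in R[i]; it is sent to R by complex.Re
   wherever a real number is needed. *)
HB.mixin Record isHilbert (R : realType) V of CompleteNormedModule R[i] V := {
  inner : {dot V for (@Num.conj R[i])} ;
  inner_norm : forall x : V, inner x x = `|x| ^+ 2
}.

#[short(type="hilbertType")]
HB.structure Definition Hilbert (R : realType) :=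
  {V of CompleteNormedModule R[i] V & isHilbert R V}.

Definition separable (T : topologicalType) : Prop :=
  exists2 D : set T, countable D & dense D.

(* The product type H * K carries the maximum norm in MathComp-Analysis, so the
   Hilbert direct sum is built on an alias of it. *)
Definition hsum (R : realType) (H K : hilbertType R) : Type := (H * K)%type.

Section DirectSum.
Context (R : realType) (H K : hilbertType R).
Local Notation C := R[i].
Local Notation HK := (hsum H K).

HB.instance Definition _ := GRing.Lmodule.copy HK (H * K)%type.

Definition hsum_norm (u : HK) : C := sqrtC (`|u.1| ^+ 2 + `|u.2| ^+ 2).

Lemma hsum_normE (u : HK) : hsum_norm u ^+ 2 = `|u.1| ^+ 2 + `|u.2| ^+ 2.
Proof. by rewrite sqrtCK. Qed.

Lemma hsum_norm_ge0 (u : HK) : 0 <= hsum_norm u.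
Proof. by rewrite sqrtC_ge0 addr_ge0 // exprn_ge0. Qed.

Lemma minkowski2 (a b c d : C) : 0 <= a -> 0 <= b -> 0 <= c -> 0 <= d ->
  sqrtC ((a + c) ^+ 2 + (b + d) ^+ 2) <=
  sqrtC (a ^+ 2 + b ^+ 2) + sqrtC (c ^+ 2 + d ^+ 2).
Proof.
move=> a0 b0 c0 d0.
have s0 (x y : C) : 0 <= x -> 0 <= y -> 0 <= x ^+ 2 + y ^+ 2.
  by move=> x0 y0; rewrite addr_ge0 // exprn_ge0.
rewrite -(@ler_pXn2r _ 2) ?nnegrE ?addr_ge0 ?sqrtC_ge0 ?s0 ?addr_ge0 //.
rewrite [leRHS]sqrrD !sqrtCK.
set s := sqrtC _; set t := sqrtC _.
have st : a * c + b * d <= s * t.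
  rewrite -(@ler_pXn2r _ 2) ?nnegrE ?addr_ge0 ?mulr_ge0 ?sqrtC_ge0 ?s0 //.
  rewrite exprMn !sqrtCK -subr_ge0.
  rewrite (_ : _ - _ = (a * d - b * c) ^+ 2); last by ring.
  by rewrite real_exprn_even_ge0 // realB // ger0_real // mulr_ge0.
rewrite -subr_ge0.
rewrite (_ : _ - _ = (s * t - (a * c + b * d)) *+ 2); last by ring.
by rewrite mulrn_wge0 // subr_ge0.
Qed.

Lemma hsum_ler_normD (u v : HK) :
  hsum_norm (u + v) <= hsum_norm u + hsum_norm v.
Proof.
apply: le_trans (minkowski2 _ _ _ _) => //.
rewrite /hsum_norm ler_sqrtC ?qualifE /= ?addr_ge0 ?exprn_ge0 ?addr_ge0 //.
by rewrite lerD // ler_pXn2r ?nnegrE ?addr_ge0 // ler_normD.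
Qed.

Lemma hsum_normrZ (l : C) (u : HK) : hsum_norm (l *: u) = `|l| * hsum_norm u.
Proof.
rewrite /hsum_norm /= !normrZ !exprMn -mulrDr sqrtCM ?qualifE /= ?exprn_ge0 //.
by rewrite sqrCK.
Qed.

Lemma hsum_normr0_eq0 (u : HK) : hsum_norm u = 0 -> u = 0.
Proof.
move=> u0; have := hsum_normE u; rewrite u0 expr0n /= => /esym/eqP.
rewrite paddr_eq0 ?exprn_ge0 // !expf_eq0 /= !normr_eq0 => /andP[/eqP h /eqP k].
by case: u {u0} h k => a b /= -> ->.
Qed.

HB.instance Definition _ := Lmodule_isNormed.Build C HK
  hsum_ler_normD hsum_normrZ hsum_normr0_eq0.

Lemma hsum_norm_fst (u : HK) : `|u.1| <= `|u|.
Proof.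
rewrite -(@ler_pXn2r _ 2) ?nnegrE // [leRHS]hsum_normE.
by rewrite lerDl exprn_ge0.
Qed.

Lemma hsum_norm_snd (u : HK) : `|u.2| <= `|u|.
Proof.
rewrite -(@ler_pXn2r _ 2) ?nnegrE // [leRHS]hsum_normE.
by rewrite lerDr exprn_ge0.
Qed.

Lemma hsum_norm_le (u : HK) : `|u| <= `|u.1| + `|u.2|.
Proof.
rewrite -(@ler_pXn2r _ 2) ?nnegrE ?addr_ge0 // [leLHS]hsum_normE sqrrD.
by rewrite lerD2r lerDl mulrn_wge0 // mulr_ge0.
Qed.

Lemma hsum_complete (F : set_system HK) : ProperFilter F -> cauchy F -> cvg F.
Proof.
move=> FF /cauchy_ballP Fc.
have F1 : cvg (fst @ F : set_system H).
  apply/cauchy_cvgP/cauchy_ballP => e e0.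
  have := Fc e e0; rewrite !near_simpl /= => -[[A B] /= [FA FB] AB].
  exists (fst @` A, fst @` B) => /=.
    split; rewrite /nbhs /=.
      by apply: filterS FA => x Ax; exists x.
    by apply: filterS FB => x Bx; exists x.
  move=> [_ _] /= [[x Ax <-] [y By <-]].
  have := AB (x, y) (conj Ax By); rewrite -!ball_normE /=.
  by apply: le_lt_trans; exact: (hsum_norm_fst (x - y)).
have F2 : cvg (snd @ F : set_system K).
  apply/cauchy_cvgP/cauchy_ballP => e e0.
  have := Fc e e0; rewrite !near_simpl /= => -[[A B] /= [FA FB] AB].
  exists (snd @` A, snd @` B) => /=.
    split; rewrite /nbhs /=.
      by apply: filterS FA => x Ax; exists x.
    by apply: filterS FB => x Bx; exists x.
  move=> [_ _] /= [[x Ax <-] [y By <-]].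
  have := AB (x, y) (conj Ax By); rewrite -!ball_normE /=.
  by apply: le_lt_trans; exact: (hsum_norm_snd (x - y)).
apply/cvg_ex; move/cvg_ex : F1 => [a Fa]; move/cvg_ex : F2 => [b Fb].
exists ((a, b) : HK); apply/cvgrPdist_lt => e e0.
have e20 : 0 < e / 2 by rewrite divr_gt0.
move/cvgrPdist_lt : Fa => /(_ _ e20) Fa.
move/cvgrPdist_lt : Fb => /(_ _ e20) Fb.
near=> u.
apply: le_lt_trans (hsum_norm_le _) _ => /=.
rewrite [ltRHS]splitr ltrD //.
  by near: u; exact: Fa.
by near: u; exact: Fb.
Unshelve. all: by end_near. Qed.

HB.instance Definition _ := Uniform_isComplete.Build HK hsum_complete.

Definition hsum_inner (u v : HK) : C := inner u.1 v.1 + inner u.2 v.2.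

Lemma hsum_inner_linearl (v : HK) : linear_for *%R (hsum_inner ^~ v).
Proof.
move=> a x y; rewrite /hsum_inner /= !linearPl /=; by ring.
Qed.

Lemma hsum_inner_linearr (u : HK) :
  linear_for (@Num.conj C \; *%R) (hsum_inner u).
Proof.
move=> a x y; rewrite /hsum_inner /= !linearPr /=; by ring.
Qed.

HB.instance Definition _ := @bilinear_isBilinear.Build C HK HK C
  *%R (@Num.conj C \; *%R) hsum_inner (conj hsum_inner_linearl hsum_inner_linearr).

Lemma hsum_inner_herm (u v : HK) :
  hsum_inner u v = (-1) ^+ false * Num.conj (hsum_inner v u).
Proof.
rewrite /hsum_inner expr0 mul1r rmorphD /=.
by rewrite (hermC _ u.1) (hermC _ u.2) !expr0 !mul1r.
Qed.

HB.instance Definition _ := @isHermitianSesquilinear.Build C HK false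
  (@Num.conj C) hsum_inner hsum_inner_herm.

Lemma hsum_inner_norm (u : HK) : hsum_inner u u = `|u| ^+ 2.
Proof. by rewrite /hsum_inner !inner_norm [RHS]hsum_normE. Qed.

Lemma hsum_inner_gt0 (u : HK) : u != 0 -> 0 < hsum_inner u u.
Proof. by move=> u0; rewrite hsum_inner_norm exprn_gt0 // normr_gt0. Qed.

HB.instance Definition _ := @isDotProduct.Build C HK hsum_inner hsum_inner_gt0.

HB.instance Definition _ := isHilbert.Build R HK hsum_inner_norm.

End DirectSum.

Section Operators.
Context (R : realType).
Implicit Types (H K : hilbertType R).

Definition bounded_op H K (A : H -> K) : Prop :=
  linear A /\ exists M : R, forall x, `|A x| <= M%:C * `|x|.

Definition opnorm H K (A : H -> K) : R :=
  sup [set complex.Re `|A x| | x in [set x : H | `|x| <= 1]].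

(* On the zero space the set is empty and its sup is 0. *)
Definition numrad H (A : H -> H) : R :=
  sup [set complex.Re `|inner (A x) x| | x in [set x : H | `|x| = 1]].

Definition adjoint H (A : H -> H) : H -> H :=
  get [set B : H -> H |
    bounded_op B /\ forall x y, inner (A x) y = inner x (B y)].

Definition spectrum H (T : H -> H) : set R[i] :=
  [set z | ~ exists S : H -> H, [/\ bounded_op S,
     cancel (fun x => z *: x - T x) S & cancel S (fun x => z *: x - T x)]].

Definition poly_op H (p : {poly R}) (T : H -> H) : H -> H :=
  fun x => \sum_(i < size p) (p`_i)%:C *: iter i T x.

(* Continuous functional calculus of a self-adjoint T, whose spectrum is real:
   f(T) is the operator-norm limit of p_n(T) for real polynomials p_n
   converging to f uniformly on the spectrum of T. *)
Definition cfc H (f : R -> R) (T : H -> H) : H -> H :=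
  get [set S : H -> H | bounded_op S /\
    exists p : nat -> {poly R},
      {uniform [set t : R | spectrum T t%:C],
         (fun n t => (p n).[t]) @ \oo --> f} /\
      opnorm (poly_op (p n) T \- S) @[n --> \oo] --> (0 : R)].

Definition absop H (A : H -> H) : H -> H := cfc Num.sqrt (adjoint A \o A).

Definition sqop H (A : H -> H) : H -> H := A \o A.

Definition reop H (A : H -> H) : H -> H :=
  fun x => 2^-1 *: (A x + adjoint A x).

Definition opmx H (A B C D : H -> H) (u : hsum H H) : hsum H H :=
  (A u.1 + B u.2, C u.1 + D u.2).

Record orlicz (phi : R -> R) : Prop := Orlicz {
  orlicz_ge0 : forall u, 0 <= u -> 0 <= phi u ;
  orlicz_convex : convex_function (`[0, +oo[%classic : set R^o) phi ;
  orlicz_continuous : {within `[0, +oo[, continuous phi} ;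
  orlicz_nondecreasing : {in `[0, +oo[ &, {homo phi : u v / u <= v}} ;
  orlicz_0 : phi 0 = 0 ;
  orlicz_gt0 : forall u, 0 < u -> 0 < phi u ;
  orlicz_infty : phi u @[u --> +oo] --> +oo
}.

End Operators.

(* Main.v *)
Require Import Defs.
From HB Require Import structures.
From mathcomp Require Import all_boot all_order all_algebra.
From mathcomp Require Import sesquilinear complex ring lra.
From mathcomp Require Import all_classical all_reals all_analysis.

Import Order.TTheory GRing.Theory Num.Theory.
Import numFieldNormedType.Exports.

Local Open Scope classical_set_scope.
Local Open Scope ring_scope.
Local Open Scope complex_scope.

(** Let A be the operator matrix with off-diagonal blocks P and Q, and let x be
    a unit vector of the direct sum. There are two bounds on |<A x, x>|^2. Both
    have a first part |A x|^2 / 4 + |adj(A) x|^2 / 4.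

    - The mixed Schwarz inequality ([mixed_schwarz]) bounds 2 |<A x, x>| by the
      form of |A| + |adj(A)|, hence by the norm of (|A| + |adj(A)|) x. Expanding
      the square of this norm leaves half the form of Re(|A| |adj(A)|) as the
      second part ([ain_offdiag_le]).
    - Buzano's inequality ([buzano]) for A x and adj(A) x leaves half of
      |<A^2 x, x>| as the second part, and A^2 is the diagonal matrix with
      blocks P Q and Q P ([ain_offdiag_buzano]).

    Since phi is convex and nondecreasing it may be applied to both bounds term
    by term ([orlicz_mix]), and the operator Jensen inequality ([jensen2]) replaces
    phi of a form by the form of phi of the operator, hence by an operator norm.
    The convex combination of the two estimates with weights alpha and 1 - alpha
    is the bound for x, and the supremum over x gives the theorem.

    The adjoint and the functional calculus enter as arbitrary choices among the
    operators meeting a specification, so their existence has to be shown, and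
    their properties follow from the specification alone. Adjoints come from a
    minimisation argument ([lax_milgram]). For the functional calculus the key
    fact is that a polynomial which is at least c on the real spectrum of a
    self-adjoint T has a form at T of at least c ([poly_op_ge]): the infimum of
    the form is a value of the polynomial at a point of the spectrum
    ([poly_op_min_spectrum]). It shows that polynomials converging uniformly on
    the spectrum converge as operators, to a limit that depends on their limit
    function only ([cfcP], [cfc_approx]), and it transfers inequalities between
    functions to operators ([cfc_ge]). Bernstein polynomials
    ([bernstein_approx]) supply the approximations of the square root and of phi. *)

Set Implicit Arguments.
Unset Strict Implicit.
Unset Printing Implicit Defensive.

(** * The underlying real Hilbert space and Buzano's inequality *)

Section RealInner.
Context {R : realType} {H : hilbertType R}.
Implicit Types (x y z u v : H) (s t : R).

(** Operator inequalities for self-adjoint operators only involve real parts of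
    inner products, so a complex Hilbert space is used below as the real one
    with norm [nr] and inner product [rin]; ordered-field reasoning then takes
    place in [R]. *)
Definition nr x : R := complex.Re `|x|.
Definition rin x y : R := complex.Re (inner x y).

Lemma nrE x : `|x| = (nr x)%:C.
Proof. by rewrite /nr RRe_real // realE normr_ge0. Qed.

Lemma nr_ge0 x : 0 <= nr x.
Proof. by rewrite -lecR -nrE normr_ge0. Qed.

Lemma nrZ (a : R[i]) x : (nr (a *: x))%:C = `|a| * (nr x)%:C.
Proof. by rewrite -!nrE normrZ. Qed.

Lemma nrZ_Re (a : R[i]) x : nr (a *: x) = complex.Re `|a| * nr x.
Proof.
by apply: complexI; rewrite nrZ rmorphM /= RRe_real // realE normr_ge0.
Qed.

Lemma nrZr t x : nr (t%:C *: x) = `|t| * nr x.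
Proof.
apply: complexI; rewrite nrZ rmorphM /=; congr (_ * _).
by rewrite normc_def /= expr0n addr0 sqrtr_sqr.
Qed.

Lemma nrD x y : nr (x + y) <= nr x + nr y.
Proof. by rewrite -lecR rmorphD /= -!nrE ler_normD. Qed.

Lemma nrN x : nr (- x) = nr x.
Proof. by rewrite /nr normrN. Qed.

Lemma nrB x y : nr (x - y) <= nr x + nr y.
Proof. by rewrite -(nrN y) nrD. Qed.

Lemma nrBC x y : nr (x - y) = nr (y - x).
Proof. by rewrite -nrN opprB. Qed.

Lemma nr0 : nr (0 : H) = 0.
Proof. by rewrite /nr normr0. Qed.

Lemma nr0_eq0 x : nr x = 0 -> x = 0.
Proof. by move=> x0; apply/eqP; rewrite -normr_eq0 nrE x0. Qed.

Lemma rinxx x : rin x x = nr x ^+ 2.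
Proof. by rewrite /rin inner_norm nrE -rmorphXn. Qed.

Lemma inner_conj x y : inner x y = Num.conj (inner y x).
Proof. by rewrite hermC expr0 mul1r. Qed.

Lemma innerZl (a : R[i]) x y : inner (a *: x) y = a * inner x y.
Proof. exact: linearZl_LR. Qed.

Lemma innerZr (a : R[i]) x y : inner x (a *: y) = Num.conj a * inner x y.
Proof. exact: linearZr_LR. Qed.

Lemma rinC x y : rin x y = rin y x.
Proof. by rewrite /rin inner_conj; case: (inner y x). Qed.

Lemma rinDl x y z : rin (x + y) z = rin x z + rin y z.
Proof. by rewrite /rin linearDl /= raddfD. Qed.

Lemma rinNl x z : rin (- x) z = - rin x z.
Proof. by rewrite /rin linearNl /= raddfN. Qed.

Lemma rinZl t x z : rin (t%:C *: x) z = t * rin x z.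
Proof.
rewrite /rin innerZl; case: (inner x z) => a b /=.
by rewrite mul0r subr0.
Qed.

(** The imaginary part of the inner product is a real part as well, which is
    why real identities determine complex ones ([inner_rin]). *)
Lemma rinZil x z : rin ('i *: x) z = - complex.Im (inner x z).
Proof.
rewrite /rin innerZl; case: (inner x z) => a b /=.
by rewrite mul0r mul1r sub0r.
Qed.

Lemma rinDr x y z : rin z (x + y) = rin z x + rin z y.
Proof. by rewrite !(rinC z) rinDl. Qed.

Lemma rinNr x z : rin z (- x) = - rin z x.
Proof. by rewrite !(rinC z) rinNl. Qed.

Lemma rinZr t x z : rin z (t%:C *: x) = t * rin z x.
Proof. by rewrite !(rinC z) rinZl. Qed.

Lemma rin0l x : rin 0 x = 0.
Proof. by rewrite -(subrr x) rinDl rinNl subrr. Qed.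

Lemma rin0r x : rin x 0 = 0.
Proof. by rewrite rinC rin0l. Qed.

Definition rinE := (rinDl, rinDr, rinNl, rinNr, rinZl, rinZr).

Lemma inner_rin x y : inner x y = rin x y +i* (- rin ('i *: x) y).
Proof. by rewrite rinZil opprK /rin; case: (inner x y). Qed.

Lemma rin_ext x y : (forall z, rin z x = rin z y) -> x = y.
Proof.
move=> xy; apply/eqP; rewrite -subr_eq0; apply/eqP/nr0_eq0/eqP.
by rewrite -sqrf_eq0 -rinxx rinDr rinNr xy subrr.
Qed.

Lemma cauchy_schwarz x y : `|rin x y| <= nr x * nr y.
Proof.
have [y0|y0] := eqVneq (nr y) 0.
  by rewrite (nr0_eq0 y0) rin0r normr0 nr0 mulr0.
rewrite -(@ler_pXn2r _ 2) ?nnegrE ?mulr_ge0 ?nr_ge0 // real_normK ?num_real //.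
set w := (nr y ^+ 2)%:C *: x - (rin x y)%:C *: y.
have := sqr_ge0 (nr w); rewrite -rinxx /w !rinE !rinxx (rinC y x).
set a := nr x; set b := nr y; set c := rin x y.
rewrite (_ : _ + _ = b ^+ 2 * ((a * b) ^+ 2 - c ^+ 2)); last by ring.
by rewrite pmulr_rge0 ?subr_ge0 // exprn_even_gt0.
Qed.

Lemma rin_le x y : rin x y <= nr x * nr y.
Proof. exact: le_trans (ler_norm _) (cauchy_schwarz _ _). Qed.

Definition ain x y : R := complex.Re `|inner x y|.

Lemma ainE x y : `|inner x y| = (ain x y)%:C.
Proof. by rewrite /ain RRe_real // realE normr_ge0. Qed.

Lemma ain_ge0 x y : 0 <= ain x y.
Proof. by rewrite -lecR -ainE normr_ge0. Qed.

(** Multiplying by a unimodular scalar turns a real inequality for [rin] into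
    one for the modulus of the inner product. *)
Lemma ain_phase x y : exists2 a : R[i], `|a| = 1 & rin (a *: x) y = ain x y.
Proof.
have [h0|h0] := eqVneq (inner x y) 0.
  by exists 1; rewrite ?normr1 // scale1r /rin /ain h0 normr0.
exists ((inner x y)^-1 * `|inner x y|).
  by rewrite normrM normfV normr_id mulVf ?normr_eq0.
by rewrite /rin innerZl mulrAC mulVf // mul1r.
Qed.

Lemma nr_unitZ (a : R[i]) x : `|a| = 1 -> nr (a *: x) = nr x.
Proof. by move=> a1; apply: complexI; rewrite nrZ a1 mul1r. Qed.

Lemma ain_le x y : ain x y <= nr x * nr y.
Proof.
have [a a1 <-] := ain_phase x y.
by rewrite -(nr_unitZ x a1) rin_le.
Qed.

(** The map x |-> 2 <x, e> e - x is a reflection, hence isometric; applying the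
    Cauchy-Schwarz inequality to its value against y bounds
    |2 <x, e><e, y> - <x, y>| by the product of the norms. *)
Lemma buzano x y e : nr e = 1 ->
  ain x e * ain e y <= 2^-1 * (nr x * nr y + ain x y).
Proof.
move=> e1.
have ee : inner e e = 1 by rewrite inner_norm nrE e1 expr1n.
set z := (2 * inner x e) *: e - x.
have zz : nr z = nr x.
  apply: complexI; rewrite -!nrE.
  apply/eqP; rewrite -(@eqrXn2 _ 2) // -!inner_norm; apply/eqP.
  rewrite /z linearBl linearBr linearBr /= !innerZl !innerZr (inner_conj e x) ee.
  rewrite rmorphM rmorph_nat /=; set c := inner x e; set w := inner x x; ring.
have zy : inner z y = 2 * (inner x e * inner e y) - inner x y.
  by rewrite /z linearBl /= innerZl /= mulrA.
have : ain z y <= nr x * nr y by rewrite -zz ain_le.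
rewrite -!lecR !rmorphM /= rmorphD !rmorphM /= -!ainE zy => h.
have two : (2^-1 : R)%:C = 2^-1 by rewrite fmorphV /= rmorph_nat.
rewrite two ler_pdivlMl // -normrM -[leLHS](@ger0_norm _ (2 * _)) ?mulr_ge0 //.
rewrite normrM normr_id -normrM.
rewrite (_ : 2 * _ = (2 * (inner x e * inner e y) - inner x y) + inner x y);
  last by ring.
by apply: le_trans (ler_normD _ _) _; rewrite lerD2r.
Qed.

End RealInner.

(** * Limits up to an arbitrary error, and completeness *)

(** Most limits of inequalities are taken in this form, which spares a topology
    on operators. *)
Lemma le_of_eps (R : realFieldType) (a b k : R) : 0 <= k ->
  (forall e : R, 0 < e -> a <= b + k * e) -> a <= b.
Proof.
move=> k0 h; rewrite leNgt; apply/negP => ba.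
have k1 : 0 < k + 1 by apply: ltr_wpDl.
have := h ((a - b) / (k + 1)); rewrite divr_gt0 ?subr_gt0 // => /(_ isT).
rewrite mulrA -lerBlDl ler_pdivlMr // mulrDr mulr1 mulrC => h1.
have : a - b <= 0 by lra.
by rewrite subr_le0 leNgt ba.
Qed.

Lemma natSinv_le (R : realType) (e : R) : 0 < e ->
  exists N, forall n, (N <= n)%N -> n.+1%:R^-1 <= e.
Proof.
move=> e0; exists (Num.truncn e^-1) => n Nn.
rewrite -[leRHS]invrK lef_pV2 ?posrE ?invr_gt0 //.
apply: le_trans (ltW (truncnS_gt _)) _.
by rewrite ler_nat.
Qed.

Section Complete.
Context {R : realType} {H : hilbertType R}.

Lemma nr_complete (u : nat -> H) :
  (forall e : R, 0 < e -> exists N, forall m n, (N <= m)%N -> (N <= n)%N ->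
     nr (u m - u n) <= e) ->
  exists l, forall e : R, 0 < e -> exists N, forall n, (N <= n)%N ->
     nr (l - u n) <= e.
Proof.
move=> hu.
have cu : cvg (u @ \oo).
  apply/cauchy_cvgP/cauchy_ballP => e; rewrite ltcE /= => /andP[/eqP e1 e0].
  have ee : e = (complex.Re e)%:C by case: e e1 {e0} => a b /= ->.
  have e20 : 0 < complex.Re e / 2 by rewrite divr_gt0.
  have [N hN] := hu _ e20.
  rewrite !near_simpl /=; exists ([set n | (N <= n)%N], [set n | (N <= n)%N]) => /=.
    by split; exists N.
  move=> [m n] /= [Nm Nn]; rewrite -ball_normE /= nrE ee ltcR.
  by apply: le_lt_trans (hN _ _ Nm Nn) _; rewrite ltr_pdivrMr // ltr_pMr // ltr1n.
move/cvg_ex : cu => [l /cvgrPdist_le ul]; exists l => e e0.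
have := ul e%:C; rewrite ltcR e0 => /(_ isT) [N _ hN].
by exists N => n Nn; rewrite -lecR -nrE; exact: hN.
Qed.

End Complete.

(** * Bounded operators *)

Section Bounded.
Context {R : realType} {H K : hilbertType R}.
Variables (A : H -> K) (bA : bounded_op A).

Lemma bopL (a : R[i]) x y : A (a *: x + y) = a *: A x + A y.
Proof. exact: (bA.1). Qed.

Lemma bopD x y : A (x + y) = A x + A y.
Proof. by rewrite -{1}(scale1r x) bopL scale1r. Qed.

Lemma bop0 : A 0 = 0.
Proof. by have := bopD 0 0; rewrite addr0 => /eqP; rewrite -subr_eq subrr eq_sym => /eqP. Qed.

Lemma bopZ (a : R[i]) x : A (a *: x) = a *: A x.
Proof. by rewrite -{1}(addr0 (a *: x)) bopL bop0 addr0. Qed.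

Lemma bopN x : A (- x) = - A x.
Proof. by rewrite -scaleN1r bopZ scaleN1r. Qed.

Lemma bopB x y : A (x - y) = A x - A y.
Proof. by rewrite bopD bopN. Qed.

Lemma bop_bound : exists2 M : R, 0 < M & forall x, nr (A x) <= M * nr x.
Proof.
case: bA => _ [M hM]; exists (`|M| + 1) => [|x]; first exact: ltr_wpDl.
have := hM x; rewrite !nrE -rmorphM /= lecR => /le_trans; apply.
by rewrite ler_wpM2r ?nr_ge0 // ler_wpDr // ler_norm.
Qed.

End Bounded.

Section BoundedOp.
Context {R : realType}.
Implicit Types H K L : hilbertType R.

Lemma bounded_opI H K (A : H -> K) (M : R) : linear A ->
  (forall x, nr (A x) <= M * nr x) -> bounded_op A.
Proof.
by move=> lA hA; split=> //; exists M => x; rewrite !nrE -rmorphM /= lecR.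
Qed.

Lemma bop_comp H K L (A : K -> L) (B : H -> K) :
  bounded_op A -> bounded_op B -> bounded_op (A \o B).
Proof.
move=> bA bB; have [M M0 hM] := bop_bound bA; have [N N0 hN] := bop_bound bB.
apply: (@bounded_opI _ _ _ (M * N)) => [a x y|x] /=; first by rewrite !bopL.
apply: le_trans (hM _) _; by rewrite -mulrA ler_wpM2l // ltW.
Qed.

Lemma bop_id H : bounded_op (@idfun H).
Proof. by apply: (@bounded_opI _ _ _ 1) => // x; rewrite mul1r. Qed.

Lemma bop_add H K (A B : H -> K) :
  bounded_op A -> bounded_op B -> bounded_op (A \+ B).
Proof.
move=> bA bB; have [M M0 hM] := bop_bound bA; have [N N0 hN] := bop_bound bB.
apply: (@bounded_opI _ _ _ (M + N)) => [a x y|x] /=.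
  by rewrite (bopL bA) (bopL bB) addrACA -scalerDr.
by apply: le_trans (nrD _ _) _; rewrite mulrDl lerD.
Qed.

Lemma bop_scale H K (A : H -> K) (a : R[i]) :
  bounded_op A -> bounded_op (fun x => a *: A x).
Proof.
move=> bA; have [M M0 hM] := bop_bound bA.
apply: (@bounded_opI _ _ _ (complex.Re `|a| * M)) => [b x y|x] /=.
  by rewrite (bopL bA) scalerDr !scalerA mulrC.
have ra : `|a| = (complex.Re `|a|)%:C by rewrite RRe_real // realE normr_ge0.
rewrite -lecR nrZ {1}ra -rmorphM lecR -mulrA ler_wpM2l //.
by rewrite -ler0c -ra normr_ge0.
Qed.

Lemma bop_sub H K (A B : H -> K) :
  bounded_op A -> bounded_op B -> bounded_op (A \- B).
Proof.
move=> bA bB; have := bop_add bA (bop_scale (-1) bB).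
by congr bounded_op; apply/funext => x /=; rewrite scaleN1r.
Qed.

Lemma bop_null H K : bounded_op (\0 : H -> K).
Proof.
apply: (@bounded_opI _ _ _ 0) => [a x y|x] /=; first by rewrite scaler0 addr0.
by rewrite mul0r nr0.
Qed.

Lemma opnorm_le H K (A : H -> K) (M : R) : 0 <= M ->
  (forall x, nr (A x) <= M * nr x) -> opnorm A <= M.
Proof.
move=> M0 hA; apply: ge_sup => [|_ [x /= x1 <-]].
  by exists (complex.Re `|A 0|), 0 => //=; rewrite normr0.
apply: le_trans (hA x) _; rewrite ler_piMr //.
by rewrite -lecR -nrE.
Qed.

Lemma nr_opnorm H K (A : H -> K) x : bounded_op A ->
  nr (A x) <= opnorm A * nr x.
Proof.
move=> bA; have [x0|x0] := eqVneq (nr x) 0.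
  by rewrite (nr0_eq0 x0) bop0 // !nr0 mulr0.
have xp : 0 < nr x by rewrite lt_neqAle eq_sym x0 nr_ge0.
have [M M0 hM] := bop_bound bA.
rewrite -ler_pdivrMr //.
set y := (nr x)^-1%:C *: x.
have -> : nr (A x) / nr x = complex.Re `|A y|.
  rewrite -[RHS]/(nr _) bopZ // nrZr ger0_norm ?invr_ge0 ?nr_ge0 //.
  by rewrite mulrC.
apply: ub_le_sup; last first.
  exists y => //=; rewrite nrE lecR nrZr ger0_norm ?invr_ge0 ?nr_ge0 //.
  by rewrite mulVf.
exists M => _ [z /= z1 <-]; apply: le_trans (hM z) _.
by rewrite ler_piMr ?(ltW M0) // -lecR -nrE.
Qed.

Lemma opnorm_ge0 H K (A : H -> K) : bounded_op A -> 0 <= opnorm A.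
Proof.
move=> bA; have [M M0 hM] := bop_bound bA; apply: ub_le_sup; last first.
  by exists 0; rewrite /= ?bop0 // normr0.
exists M => _ [z /= z1 <-]; apply: le_trans (hM z) _.
by rewrite ler_piMr ?(ltW M0) // -lecR -nrE.
Qed.

End BoundedOp.

(** * Coercive operators, adjoints and real spectra *)

Section LaxMilgram.
Context {R : realType} {H : hilbertType R}.

Definition selfadj (T : H -> H) : Prop :=
  bounded_op T /\ forall x y, rin (T x) y = rin x (T y).

(** The solution is the minimiser of J z = <B z, z> - 2 g z, half the derivative
    of J at z in the direction x being <B z, x> - g x. With B the identity this
    is the Riesz representation theorem; with g = <y, _> it says that a
    coercive self-adjoint operator is onto. *)
Lemma lax_milgram (B : H -> H) (g : H -> R) (d C : R) : selfadj B -> 0 < d ->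
  (forall x, d * nr x ^+ 2 <= rin (B x) x) ->
  (forall t x y, g (t%:C *: x + y) = t * g x + g y) ->
  (forall x, g x <= C * nr x) ->
  exists z, forall x, rin (B z) x = g x.
Proof.
move=> [bB sB] d0 hB gL gC.
pose J z := rin (B z) z - 2 * g z.
have g0 : g 0 = 0.
  by have := gL 1 0 0; rewrite scaler0 addr0 mul1r; lra.
have gZ t x : g (t%:C *: x) = t * g x by rewrite -[LHS](congr1 g (addr0 _)) gL g0 addr0.
have gD x y : g (x + y) = g x + g y by rewrite -{1}(scale1r x) gL mul1r.
have J0 z : - (C ^+ 2 / d) <= J z.
  have h1 := gC z; have h2 := hB z.
  have h3 : 0 <= (d * nr z - C) ^+ 2 / d by rewrite divr_ge0 ?sqr_ge0 // ltW.
  have e : (d * nr z - C) ^+ 2 / d = d * nr z ^+ 2 - 2 * (C * nr z) + C ^+ 2 / d.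
    by field; rewrite gt_eqF.
  rewrite /J; lra.
have hinf : has_inf (range J).
  by split; [exists (J 0), 0|exists (- (C ^+ 2 / d)) => _ [z _ <-]].
set m := inf (range J).
have Jm z : m <= J z by apply: ge_inf; [case: hinf|exists z].
have /choice[u uP] : forall n, exists z, J z < m + n.+1%:R^-1.
  move=> n; have n0 : 0 < n.+1%:R^-1 :> R by rewrite invr_gt0.
  by have [_ [z _ <-] zn] := inf_adherent n0 hinf; exists z.
(* The parallelogram identity for the form of B: a minimising sequence is
   Cauchy. *)
have mid a b : d / 2 * nr (a - b) ^+ 2 <= J a + J b - 2 * m.
  have h1 := Jm (2^-1%:C *: (a + b)); have := hB (a - b).
  move: h1; rewrite /J !(bopZ bB) !(bopB bB) !(bopD bB) !gZ !gD !rinE.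
  rewrite (sB b a) (rinC b (B a)) => h1 h2; lra.
have [e he|z hz] := @nr_complete _ _ u.
  have e0 : 0 < d * e ^+ 2 / 4 by rewrite divr_gt0 // mulr_gt0 // exprn_gt0.
  have [N hN] := natSinv_le e0; exists N => i j Ni Nj.
  rewrite -(@ler_pXn2r _ 2) ?nnegrE ?nr_ge0 ?(ltW he) //.
  have h := mid (u i) (u j); have h1 := uP i; have h2 := uP j.
  have h3 := hN _ Ni; have h4 := hN _ Nj.
  have : d * nr (u i - u j) ^+ 2 <= d * e ^+ 2.
    move: h h1 h2 h3 h4; rewrite -/m; set q1 := i.+1%:R^-1; set q2 := j.+1%:R^-1.
    move: (nr _) (J _) (J _) q1 q2 => r j1 j2 q1 q2 h h1 h2 h3 h4; lra.
  by rewrite ler_pM2l.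
have [L L0 hL] := bop_bound bB.
(* The first-order condition is tested along the minimising sequence itself, so
   that no continuity of J is involved. *)
have main x : g x <= rin (B z) x.
  have key (s : R) : 0 < s -> 0 <= 2 * s * (rin (B z) x - g x) + s ^+ 2 * rin (B x) x.
    move=> s0; apply: (@le_of_eps _ _ _ (2 * s * (L * nr x) + 1)).
      by rewrite addr_ge0 // !mulr_ge0 ?nr_ge0 // ltW.
    move=> e e0; have [N1 hN1] := hz _ e0; have [N2 hN2] := natSinv_le e0.
    pose n := maxn N1 N2; have := hN1 n (leq_maxl _ _); have := hN2 n (leq_maxr _ _).
    have := uP n; have := Jm (u n + s%:C *: x).
    have : rin (B (u n)) x <= rin (B z) x + L * nr x * nr (z - u n).
      have := cauchy_schwarz (B (z - u n)) x; rewrite ler_norml => /andP[+ _].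
      have := ler_wpM2r (nr_ge0 x) (hL (z - u n)).
      rewrite (bopB bB) [in rin (_ - _) _]rinDl rinNl.
      move: (nr _) (nr _) (nr _) (rin _ _) (rin _ _) => r1 r2 r3 p1 p2; lra.
    set v := u n; set r := nr (z - v); move: r => r.
    rewrite /J !(bopD bB) !gD !gZ !(bopZ bB) !rinE.
    rewrite (sB x v) (rinC x (B v)).
    set q := n.+1%:R^-1 => h1 h2 h3 h4 h5.
    have h6 : L * nr x * r <= L * nr x * e.
      by apply: ler_wpM2l => //; rewrite mulr_ge0 ?nr_ge0 // ltW.
    have := ler_wpM2l (ltW s0) (le_trans h1 (lerD (lexx _) h6)).
    move: h2 h3 h4 h6; clear h1 h5; move: (rin (B v) v) (rin (B v) x) (rin (B z) x) (rin (B x) x).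
    move: (g v) (g x) (nr x) q r => gv gx nx q r p1 p2 p3 p4 h2 h3 h4 h6 h7.
    lra.
  rewrite -subr_ge0; apply: (@le_of_eps _ _ _ (`|rin (B x) x|)) => // e e0.
  have := key _ e0; rewrite (_ : _ + _ = e * (2 * (rin (B z) x - g x) + e * rin (B x) x)).
    rewrite pmulr_rge0 // => h.
    have := ler_wpM2l (ltW e0) (ler_norm (rin (B x) x)).
    have : 0 <= `|rin (B x) x| * e by rewrite mulr_ge0 // ltW.
    lra.
  by ring.
exists z => x; apply/eqP; rewrite eq_le main andbT.
have := main (- x); rewrite rinNr -scaleN1r.
have -> : (-1 : R[i]) = (-1 : R)%:C by rewrite rmorphN1.
by rewrite gZ mulN1r lerN2.
Qed.

Lemma adjointP (A : H -> H) : bounded_op A ->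
  bounded_op (adjoint A) /\ forall x y, inner (A x) y = inner x (adjoint A y).
Proof.
move=> bA; apply: (@getPex _ [set B : H -> H |
    bounded_op B /\ forall x y, inner (A x) y = inner x (B y)]).
have [M M0 hM] := bop_bound bA.
have /choice[B hB] : forall y, exists z, forall x, rin (A x) y = rin x z.
  move=> y; have [|||||z hz] := @lax_milgram idfun (fun x => rin (A x) y) 1 (M * nr y).
  - by split=> //; exact: bop_id.
  - exact: ltr01.
  - by move=> x; rewrite mul1r /= rinxx.
  - by move=> t x x'; rewrite bopL // rinE rinZl.
  - move=> x; apply: le_trans (rin_le _ _) _.
    by rewrite mulrAC ler_wpM2r ?nr_ge0.
  by exists z => x; rewrite -hz rinC.
have hBi x y : inner (A x) y = inner x (B y).
  by rewrite [LHS]inner_rin [RHS]inner_rin -!hB bopZ.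
exists B; split => //; apply: (@bounded_opI _ _ _ _ M) => [a x y|y].
  apply: rin_ext => z; rewrite /rin -hBi !linearDr /= !innerZr.
  by rewrite -!hBi.
have [y0|y0] := eqVneq (nr (B y)) 0; first by rewrite y0 mulr_ge0 ?nr_ge0 ?ltW.
have yp : 0 < nr (B y) by rewrite lt_neqAle eq_sym y0 nr_ge0.
rewrite -(ler_pM2r yp) -expr2 -rinxx -hB.
apply: le_trans (rin_le _ _) _; rewrite mulrAC ler_wpM2r ?nr_ge0 //.
Qed.

Lemma adjoint_bop (A : H -> H) : bounded_op A -> bounded_op (adjoint A).
Proof. by move=> /adjointP[]. Qed.

Lemma rin_adj (A : H -> H) x y : bounded_op A ->
  rin (A x) y = rin x (adjoint A y).
Proof. by move=> /adjointP[_ h]; rewrite /rin h. Qed.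

Lemma adjoint_eq (A B : H -> H) : bounded_op A ->
  (forall x y, rin (A x) y = rin x (B y)) -> adjoint A = B.
Proof.
by move=> bA h; apply/funext => y; apply: rin_ext => x; rewrite -h rin_adj.
Qed.

Lemma adjointK (A : H -> H) : bounded_op A -> adjoint (adjoint A) = A.
Proof.
move=> bA; apply: adjoint_eq; first exact: adjoint_bop.
by move=> x y; rewrite rinC -rin_adj // rinC.
Qed.

Lemma coercive_inv (B : H -> H) (d : R) : selfadj B -> 0 < d ->
  (forall x, d * nr x ^+ 2 <= rin (B x) x) ->
  exists S, [/\ bounded_op S, cancel B S & cancel S B].
Proof.
move=> sB d0 hB; have [bB _] := sB.
have low x : d * nr x <= nr (B x).
  have [x0|x0] := eqVneq (nr x) 0; first by rewrite x0 mulr0 nr_ge0.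
  have xp : 0 < nr x by rewrite lt_neqAle eq_sym x0 nr_ge0.
  rewrite -(ler_pM2r xp) -mulrA -expr2; exact: le_trans (hB x) (rin_le _ _).
have /choice[S hS] : forall y, exists z, B z = y.
  move=> y; have [| |z hz] := @lax_milgram B (rin y) d (nr y) sB d0 hB.
  - by move=> t x x'; rewrite !rinE.
  - by move=> x; exact: rin_le.
  by exists z; apply: rin_ext => x; rewrite !(rinC x).
have injB x y : B x = B y -> x = y.
  move=> xy; apply/eqP; rewrite -subr_eq0; apply/eqP/nr0_eq0.
  have := low (x - y); rewrite bopB // xy subrr nr0 pmulr_rle0 // => h.
  by apply/eqP; rewrite eq_le h nr_ge0.
exists S; split=> [| x | x]; [|by apply: injB; rewrite hS|exact: hS].
apply: (@bounded_opI _ _ _ _ d^-1) => [a x y|x].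
  by apply: injB; rewrite (bopL bB) !hS.
by rewrite ler_pdivlMl //; apply: le_trans (low _) _; rewrite hS.
Qed.

Lemma selfadj_shift (T : H -> H) (s t : R) : selfadj T ->
  selfadj (fun x => s%:C *: x + t%:C *: T x).
Proof.
move=> [bT sT]; split=> [|x y]; last by rewrite !rinE sT.
have := bop_add (bop_scale s%:C (bop_id H)) (bop_scale t%:C bT).
by [].
Qed.

(** Outside [m, M] the operator t - T, or its opposite, is coercive, hence
    invertible. *)
Lemma spectrum_itv (T : H -> H) (m M t : R) : selfadj T ->
  (forall x, m * nr x ^+ 2 <= rin (T x) x <= M * nr x ^+ 2) ->
  spectrum T t%:C -> m <= t <= M.
Proof.
move=> sT hT; apply: contraPT; rewrite negb_and -!ltNge => /orP[tm|tM]; apply.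
  have [|||S [bS S1 S2]] := @coercive_inv (fun x => (- t)%:C *: x + 1%:C *: T x) (m - t).
  - exact: selfadj_shift.
  - by rewrite subr_gt0.
  - by move=> x; rewrite !rinE rinxx; case/andP: (hT x) => h _; lra.
  have eT x : t%:C *: x - T x = - ((- t)%:C *: x + 1%:C *: T x).
    by rewrite opprD rmorphN /= scaleNr scale1r opprK.
  exists (fun x => -1 *: S x); split => [|x|x] /=; first exact: bop_scale.
    by rewrite eT (bopN bS) S1 scaleN1r opprK.
  by rewrite eT scaleN1r -(bopN bS) S2 opprK.
have [|||S [bS S1 S2]] := @coercive_inv (fun x => t%:C *: x + (-1)%:C *: T x) (t - M).
- exact: selfadj_shift.
- by rewrite subr_gt0.
- by move=> x; rewrite !rinE rinxx; case/andP: (hT x) => _ h; lra.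
have eT x : t%:C *: x - T x = t%:C *: x + (-1)%:C *: T x.
  by rewrite rmorphN1 scaleN1r.
by exists S; split => // x; rewrite eT.
Qed.

(** Positivity of the form at the vector x - L^-1 T x. *)
Lemma nr_sqr_le_form (T : H -> H) (L : R) : selfadj T -> 0 < L ->
  (forall x, 0 <= rin (T x) x <= L * nr x ^+ 2) ->
  forall x, nr (T x) ^+ 2 <= L * rin (T x) x.
Proof.
move=> [bT sT] L0 hT x.
have /andP[h1 _] := hT (x - L^-1%:C *: T x); have /andP[_ h2] := hT (T x).
move: h1; rewrite bopB // bopZ // !rinE (sT (T x) x) rinxx => h1.
have h3 : L^-1 * (L^-1 * rin (T (T x)) (T x)) <= L^-1 * nr (T x) ^+ 2.
  by rewrite ler_pM2l ?invr_gt0 // ler_pdivrMl.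
rewrite mulrC -ler_pdivrMr // mulrC.
move: h1 h3; set a := L^-1 * (L^-1 * _); lra.
Qed.

End LaxMilgram.

(** * Polynomials in an operator *)

Section PolyOp.
Context {R : realType} {H : hilbertType R}.
Local Notation C := R[i].
Implicit Types (T : H -> H) (p q : {poly C}) (x y : H).

(** Complex coefficients, in contrast with [poly_op], so that polynomials split
    into linear factors. *)
Definition cpoly_op p T x : H := \sum_(i < size p) p`_i *: iter i T x.

Lemma cpoly_op_widen n p T x : (size p <= n)%N ->
  cpoly_op p T x = \sum_(i < n) p`_i *: iter i T x.
Proof.
move=> pn; rewrite /cpoly_op (big_ord_widen _ (fun i => p`_i *: iter i T x) pn).
rewrite [RHS](bigID (fun i : 'I_n => (i < size p)%N)) /= [X in _ + X]big1 ?addr0 //.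
by move=> i; rewrite -leqNgt => /(nth_default 0) ->; rewrite scale0r.
Qed.

Lemma cpoly_opD p q T x : cpoly_op (p + q) T x = cpoly_op p T x + cpoly_op q T x.
Proof.
have h := size_polyD p q.
rewrite (cpoly_op_widen T x h) (@cpoly_op_widen (maxn (size p) (size q)) p) ?leq_maxl //.
rewrite (@cpoly_op_widen (maxn (size p) (size q)) q) ?leq_maxr // -big_split /=.
by apply: eq_bigr => i _; rewrite coefD scalerDl.
Qed.

Lemma cpoly_opZ (a : C) p T x : cpoly_op (a *: p) T x = a *: cpoly_op p T x.
Proof.
rewrite (cpoly_op_widen T x (size_scale_leq a p)) /cpoly_op scaler_sumr.
by apply: eq_bigr => i _; rewrite coefZ scalerA.
Qed.

Lemma cpoly_opC (a : C) T x : cpoly_op a%:P T x = a *: x.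
Proof.
by rewrite (cpoly_op_widen T x (size_polyC_leq1 a)) big_ord1 coefC eqxx.
Qed.

Lemma cpoly_opMX p T x : cpoly_op (p * 'X) T x = cpoly_op p T (T x).
Proof.
have h : (size (p * 'X)%R <= (size p).+1)%N.
  by apply: leq_trans (size_polyMleq _ _) _; rewrite size_polyX addn2.
rewrite (cpoly_op_widen T x h) big_ord_recl coefMX eqxx scale0r add0r /cpoly_op.
by apply: eq_bigr => i _; rewrite coefMX /= -iterS iterSr.
Qed.

Lemma cpoly_opB p q T x : cpoly_op (p - q) T x = cpoly_op p T x - cpoly_op q T x.
Proof. by rewrite cpoly_opD -scaleN1r cpoly_opZ scaleN1r. Qed.

Lemma bop_cpoly_op p T : bounded_op T -> bounded_op (cpoly_op p T).
Proof.
move=> bT; elim/poly_ind: p => [|p a IH].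
  by rewrite (_ : cpoly_op 0 T = \0); [exact: bop_null|apply/funext => x;
    rewrite -(scale0r 0) cpoly_opZ scale0r].
have -> : cpoly_op (p * 'X + a%:P) T = (cpoly_op p T \o T) \+ (fun x => a *: idfun x).
  by apply/funext => x; rewrite cpoly_opD cpoly_opMX cpoly_opC.
by apply: bop_add; [exact: bop_comp|exact/bop_scale/bop_id].
Qed.

Lemma cpoly_opXsubM p T (a : C) x : bounded_op T ->
  cpoly_op (('X - a%:P) * p) T x = cpoly_op p T (T x - a *: x).
Proof.
move=> bT; have bp := bop_cpoly_op p bT.
by rewrite mulrC mulrBr cpoly_opB cpoly_opMX mulrC mul_polyC cpoly_opZ (bopB bp) (bopZ bp).
Qed.

(** A product of linear factors in T is bounded below as soon as every factor
    is. The contrapositive is how a root of a polynomial is located in the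
    spectrum. *)
Lemma cpoly_op_prod_lower (r : seq C) T : bounded_op T ->
  (forall a, a \in r -> exists2 d : R, 0 < d &
     forall x, d * nr x <= nr (T x - a *: x)) ->
  exists2 d : R, 0 < d &
    forall x, d * nr x <= nr (cpoly_op (\prod_(a <- r) ('X - a%:P)) T x).
Proof.
move=> bT; elim: r => [_|a r IH hr].
  by exists 1 => // x; rewrite big_nil cpoly_opC scale1r mul1r.
have [|d d0 hd] := IH; first by move=> b br; apply: hr; rewrite inE br orbT.
have [|e e0 he] := hr a; first by rewrite inE eqxx.
exists (d * e) => [|x]; first exact: mulr_gt0.
rewrite big_cons cpoly_opXsubM // -mulrA; apply: le_trans (hd _).
by rewrite ler_pM2l.
Qed.

End PolyOp.

(** * Spectral bounds for polynomials in a self-adjoint operator *)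

Section RealPoly.
Context {R : realType} {H : hilbertType R}.
Local Notation toC := (map_poly (real_complex R)).
Implicit Types (T : H -> H) (p q : {poly R}) (x y : H).

Lemma poly_opE p T : poly_op p T = cpoly_op (toC p) T.
Proof.
apply/funext => x; rewrite /poly_op /cpoly_op size_map_poly.
by apply: eq_bigr => i _; rewrite coef_map.
Qed.

Lemma poly_opD p q T x : poly_op (p + q) T x = poly_op p T x + poly_op q T x.
Proof. by rewrite !poly_opE rmorphD cpoly_opD. Qed.

Lemma poly_opB p q T x : poly_op (p - q) T x = poly_op p T x - poly_op q T x.
Proof. by rewrite !poly_opE rmorphB cpoly_opB. Qed.

Lemma poly_opN p T x : poly_op (- p) T x = - poly_op p T x.
Proof. by rewrite !poly_opE rmorphN -scaleN1r cpoly_opZ scaleN1r. Qed.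

Lemma poly_opC (a : R) T x : poly_op a%:P T x = a%:C *: x.
Proof. by rewrite !poly_opE map_polyC cpoly_opC. Qed.

Lemma poly_opMX p T x : poly_op (p * 'X) T x = poly_op p T (T x).
Proof. by rewrite !poly_opE rmorphM /= map_polyX cpoly_opMX. Qed.

Lemma poly_opX T x : poly_op 'X T x = T x.
Proof. by rewrite -['X]mul1r poly_opMX poly_opC scale1r. Qed.

Lemma poly_opMC p (a : R) T x : poly_op (a%:P * p) T x = a%:C *: poly_op p T x.
Proof. by rewrite !poly_opE rmorphM /= map_polyC mul_polyC cpoly_opZ. Qed.

Lemma bop_poly_op p T : bounded_op T -> bounded_op (poly_op p T).
Proof. by rewrite poly_opE; exact: bop_cpoly_op. Qed.

Lemma poly_op_comm p T x : bounded_op T ->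
  poly_op p T (T x) = T (poly_op p T x).
Proof.
move=> bT; elim/poly_ind: p x => [|p a IH] x.
  by rewrite !poly_opC !scale0r bop0.
by rewrite !poly_opD !poly_opMX !poly_opC (bopD bT) (bopZ bT) IH.
Qed.

Lemma poly_opM p q T x : bounded_op T ->
  poly_op (p * q) T x = poly_op p T (poly_op q T x).
Proof.
move=> bT; elim/poly_ind: p x => [|p a IH] x.
  by rewrite mul0r !poly_opC !scale0r.
rewrite mulrDl mulrAC !poly_opD !poly_opMX poly_opMC poly_opC IH.
by rewrite poly_op_comm.
Qed.

Lemma selfadj_poly_op p T : selfadj T -> selfadj (poly_op p T).
Proof.
move=> [bT sT]; split; first exact: bop_poly_op.
elim/poly_ind: p => [|p a IH] x y.
  by rewrite !poly_opC !scale0r rin0l rin0r.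
by rewrite !poly_opD !poly_opMX !poly_opC !rinE IH sT poly_op_comm.
Qed.

Lemma poly_op_comp_sqr p T x : bounded_op T ->
  poly_op (p \Po 'X^2) T x = poly_op p (T \o T) x.
Proof.
move=> bT; elim/poly_ind: p x => [|p a IH] x.
  by rewrite comp_poly0 !poly_opC.
rewrite comp_polyD comp_polyM comp_polyC comp_polyX expr2 mulrA.
by rewrite !poly_opD !poly_opMX !poly_opC IH.
Qed.

Lemma not_spectrum_lower T (t : R) : ~ spectrum T t%:C ->
  exists2 d : R, 0 < d & forall x, d * nr x <= nr (T x - t%:C *: x).
Proof.
move=> /contrapT[S [bS S1 _]]; have [M M0 hM] := bop_bound bS.
exists M^-1 => [|x]; first by rewrite invr_gt0.
by rewrite ler_pdivrMl // nrBC -{1}[x]S1.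
Qed.

(** For a = s + i t, the vectors (T - s) x and i x are orthogonal for the real
    inner product, because <(T - s) x, x> is real; hence
    |(T - a) x|^2 = |(T - s) x|^2 + t^2 |x|^2. *)
Lemma nonreal_lower T (a : R[i]) : selfadj T -> complex.Im a != 0 ->
  exists2 d : R, 0 < d & forall x, d * nr x <= nr (T x - a *: x).
Proof.
move=> [bT sT] a0; exists `|complex.Im a| => [|x]; first by rewrite normr_gt0.
rewrite -(@ler_pXn2r _ 2) ?nnegrE ?mulr_ge0 ?nr_ge0 //.
rewrite exprMn real_normK ?num_real // -(rinxx (_ - _)).
set s := complex.Re a; set t := complex.Im a.
have -> : T x - a *: x = T x - s%:C *: x - t%:C *: ('i *: x).
  rewrite -addrA -opprD scalerA -scalerDl; congr (_ - _ *: _).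
  by rewrite mulrC -complexE.
have ix : rin ('i *: x) ('i *: x) = nr x ^+ 2.
  by rewrite rinxx nr_unitZ // normc_def /= expr0n expr1n add0r sqrtr1.
have x0 : rin ('i *: x) x = 0.
  by rewrite rinZil inner_norm nrE -rmorphXn /= oppr0.
have Tx0 : rin ('i *: x) (T x) = 0.
  have : rin (T ('i *: x)) x = rin ('i *: x) (T x) by rewrite sT.
  rewrite bopZ // !rinZil (inner_conj x) /=; case: (inner (T x) x) => u v /=.
  rewrite opprK; lra.
have := sqr_ge0 (nr (T x - s%:C *: x)).
rewrite -(rinxx (_ - _)) !rinE !(rinC _ ('i *: x)) ix x0 Tx0; lra.
Qed.

(** The infimum m of the form of q(T) over the unit sphere is a value of q on the
    spectrum of T. Indeed q(T) - m is not bounded below on unit vectors; up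
    to a nonzero scalar it is the product of the factors T - a over the complex
    roots a of q - m, so some factor is not bounded below, and such a root is
    real and lies in the spectrum. *)
Lemma poly_op_min_spectrum T q (x0 : H) : selfadj T -> (1 < size q)%N -> x0 != 0 ->
  exists2 t : R, spectrum T t%:C &
    forall x, q.[t] * nr x ^+ 2 <= rin (poly_op q T x) x.
Proof.
move=> sT q1 x00; have bT := sT.1; set B := poly_op q T.
have sB : selfadj B by exact: selfadj_poly_op.
have [bB _] := sB; have [M M0 hM] := bop_bound bB.
have absB x : `|rin (B x) x| <= M * nr x ^+ 2.
  apply: le_trans (cauchy_schwarz _ _) _.
  by rewrite expr2 mulrA ler_wpM2r ?nr_ge0.
pose E := [set rin (B x) x | x in [set x : H | nr x = 1]].
have normalize x : x != 0 -> nr ((nr x)^-1%:C *: x) = 1.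
  move=> x1; have : nr x != 0 by apply: contra_neq x1; exact: nr0_eq0.
  by move=> h; rewrite nrZr ger0_norm ?invr_ge0 ?nr_ge0 // mulVf.
have hE : has_inf E.
  split; first by eexists; exists ((nr x0)^-1%:C *: x0) => //=; exact: normalize.
  exists (- M) => _ [x /= x1 <-]; have := absB x.
  by rewrite x1 expr1n mulr1 ler_norml => /andP[].
have [m mE] : {m | m = inf E} by exists (inf E).
have mB x : m * nr x ^+ 2 <= rin (B x) x.
  have [->|x1] := eqVneq x 0; first by rewrite bop0 // rin0l nr0 expr0n mulr0.
  have xp : 0 < nr x.
    rewrite lt_neqAle nr_ge0 andbT eq_sym.
    by apply: contra_neq x1; exact: nr0_eq0.
  have : m <= rin (B ((nr x)^-1%:C *: x)) ((nr x)^-1%:C *: x).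
    by rewrite mE; apply: ge_inf; [case: hE|exists ((nr x)^-1%:C *: x) => //=; exact: normalize].
  rewrite bopZ // !rinE mulrA -invfM -expr2 mulrC.
  by rewrite ler_pdivlMr ?exprn_gt0.
pose D x := (- m)%:C *: x + 1%:C *: B x.
have sD : selfadj D by exact: selfadj_shift.
pose L := M + `|m|.
have L0 : 0 < L by rewrite ltr_pwDl.
have DL x : 0 <= rin (D x) x <= L * nr x ^+ 2.
  rewrite /D !rinE rinxx; have := mB x; have := absB x.
  rewrite ler_norml => /andP[_ h1] h2.
  have := ler_wpM2r (sqr_ge0 (nr x)) (ler_norm (- m)); rewrite normrN /L => h3.
  by apply/andP; split; lra.
(* Vectors almost minimising the form are almost in the kernel of D, as D is
   positive. *)
have Dsmall (e : R) : 0 < e -> exists2 x, nr x = 1 & nr (D x) ^+ 2 <= e.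
  move=> e0; have e1 : 0 < e / L by rewrite divr_gt0.
  have [_ [x /= x1 <-] hx] := inf_adherent e1 hE; exists x => //.
  apply: le_trans (nr_sqr_le_form sD L0 DL x) _.
  rewrite mulrC -ler_pdivlMr // /D !rinE rinxx x1 expr1n.
  by move: hx; rewrite -mE; lra.
pose c := toC q - m%:C%:P.
have cD x : cpoly_op c T x = D x.
  by rewrite cpoly_opB cpoly_opC -poly_opE -/B /D rmorphN /= scaleNr [RHS]addrC scale1r.
have szc : size c = size q.
  rewrite /c size_polyDl ?size_map_poly // size_polyN.
  by apply: leq_ltn_trans (size_polyC_leq1 _) _.
have lc0 : lead_coef c != 0.
  by rewrite lead_coef_eq0 -size_poly_gt0 szc ltnW.
have [l [r [l0 hr]]] : exists l r, l != 0 /\ c = l *: \prod_(z <- r) ('X - z%:P).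
  by have [r hr] := closed_field_poly_normal c; exists (lead_coef c), r.
suff : exists t, spectrum T t%:C /\ q.[t] = m.
  by move=> [t [tT qt]]; exists t => // x; rewrite qt.
apply: contrapT => no.
have [a ar|d d0 hd] := cpoly_op_prod_lower (r := r) bT.
  have [a0|a0] := eqVneq (complex.Im a) 0; last exact: nonreal_lower.
  have ea : a = (complex.Re a)%:C by case: (a) a0 => u v /= ->.
  rewrite ea; apply: not_spectrum_lower => st; apply: no.
  exists (complex.Re a); split => //; apply: complexI.
  have : root c a.
    by rewrite hr rootZ // root_prod_XsubC.
  rewrite ea /root /c !hornerE /= horner_map subr_eq0 => /eqP.
  by [].
have lp : 0 < complex.Re `|l|.
  by rewrite -ltcR RRe_real ?normr_gt0 // realE normr_ge0.
have low x : complex.Re `|l| * d * nr x <= nr (D x).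
  by rewrite -cD hr cpoly_opZ nrZ_Re -mulrA ler_pM2l.
set k := _ * d in low.
have k0 : 0 < k by exact: mulr_gt0.
have [|x x1 hx] := Dsmall (k ^+ 2 / 2); first by rewrite divr_gt0 // exprn_gt0.
have := low x; rewrite x1 mulr1 => h.
have : k ^+ 2 <= nr (D x) ^+ 2 by rewrite ler_pXn2r // nnegrE ?nr_ge0 // ltW.
have k2 : 0 < k ^+ 2 by rewrite exprn_gt0.
lra.
Qed.

(** A constant polynomial says nothing about T: for it, a point of the spectrum
    is obtained from the polynomial 'X instead. *)
Lemma poly_op_ge T q (c : R) : selfadj T ->
  (forall t : R, spectrum T t%:C -> c <= q.[t]) ->
  forall x, c * nr x ^+ 2 <= rin (poly_op q T x) x.
Proof.
move=> sT hq x; have [->|x0] := eqVneq x 0.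
  by rewrite rin0r nr0 expr0n mulr0.
have [q1|q1] := leqP (size q) 1.
  have [t st _] := poly_op_min_spectrum (q := 'X) sT (ltac:(by rewrite size_polyX)) x0.
  have := hq _ st; rewrite (size1_polyC q1) hornerC poly_opC rinE rinxx => h.
  by rewrite ler_wpM2r // sqr_ge0.
have [t st ht] := poly_op_min_spectrum sT q1 x0.
by apply: le_trans (ht x); rewrite ler_wpM2r ?sqr_ge0 // hq.
Qed.

Lemma poly_op_le T q (c : R) : selfadj T ->
  (forall t : R, spectrum T t%:C -> q.[t] <= c) ->
  forall x, rin (poly_op q T x) x <= c * nr x ^+ 2.
Proof.
move=> sT hq x; rewrite -lerN2 -mulNr -rinNl -poly_opN.
by apply: poly_op_ge => // t /hq; rewrite hornerN lerN2.
Qed.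

(** The form of q(T)^2 is that of q^2 at T, so the form bound for q^2 is a norm
    bound for q(T). *)
Lemma nr_poly_op T q (c : R) : selfadj T -> 0 <= c ->
  (forall t : R, spectrum T t%:C -> `|q.[t]| <= c) ->
  forall x, nr (poly_op q T x) <= c * nr x.
Proof.
move=> sT c0 hq x.
rewrite -(@ler_pXn2r _ 2) ?nnegrE ?mulr_ge0 ?nr_ge0 // exprMn -rinxx.
have [_ <-] := selfadj_poly_op q sT; rewrite -(poly_opM q q x sT.1).
apply: poly_op_le => // t /hq h; rewrite hornerM -expr2.
rewrite (_ : _ ^+ 2 = `|q.[t]| ^+ 2); last by rewrite real_normK // num_real.
by rewrite lerXn2r ?nnegrE.
Qed.

End RealPoly.

(** * Continuous functional calculus of a positive operator *)

Lemma uniform_cvgP (R : realType) (A : set R) (F : nat -> R -> R) (f : R -> R) :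
  {uniform A, F @ \oo --> f} <->
  (forall e : R, 0 < e -> exists N, forall n, (N <= n)%N ->
     forall t, A t -> `|F n t - f t| <= e).
Proof.
split=> [h e e0|h P /uniform_nbhs [E [entE EP]]].
  have : nbhs (f : {uniform` A -> R}) [set g | forall t, A t -> ball (f t) e (g t)].
    apply/uniform_nbhs; exists [set xy | ball xy.1 e xy.2]; split => //.
    exact: entourage_ball (PosNum e0).
  move=> /h [N _ hN]; exists N => n Nn t At.
  by have /= := hN n Nn t At; rewrite -ball_normE /= distrC => /ltW.
move: entE; rewrite -entourage_ballE => -[e /= e0 eE].
have e20 : 0 < e / 2 by rewrite divr_gt0.
have [N hN] := h _ e20; exists N => // n /= Nn; apply: EP => t At /=.
apply: eE; rewrite /= -ball_normE /= distrC; apply: le_lt_trans (hN _ Nn _ At) _.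
by rewrite ltr_pdivrMr // ltr_pMr // ltr1n.
Qed.

Definition poly_approx (R : realType) (f : R -> R) (M : R) : Prop :=
  forall e : R, 0 < e -> exists p : {poly R},
    forall t, 0 <= t <= M -> `|p.[t] - f t| <= e.

Section Cfc.
Context {R : realType} {H : hilbertType R}.
Variables (T : H -> H) (M : R) (f : R -> R).
Hypotheses (sT : selfadj T)
  (hT : forall x, 0 <= rin (T x) x <= M * nr x ^+ 2)
  (hf : poly_approx f M).

Let bT : bounded_op T := sT.1.

Let spec_itv t : spectrum T t%:C -> 0 <= t <= M.
Proof.
by apply: spectrum_itv => // x; rewrite mul0r.
Qed.

(** Polynomials converging to f on [0, M], which contains the spectrum, give a
    Cauchy sequence of operators by [nr_poly_op]; its limit meets the
    specification by which [cfc f T] is chosen. *)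
Lemma cfcP : bounded_op (cfc f T) /\
    exists p : nat -> {poly R},
      {uniform [set t : R | spectrum T t%:C],
         (fun n t => (p n).[t]) @ \oo --> f} /\
      opnorm (poly_op (p n) T \- cfc f T) @[n --> \oo] --> (0 : R).
Proof.
apply: (@getPex _ [set S : H -> H | bounded_op S /\
    exists p : nat -> {poly R},
      {uniform [set t : R | spectrum T t%:C],
         (fun n t => (p n).[t]) @ \oo --> f} /\
      opnorm (poly_op (p n) T \- S) @[n --> \oo] --> (0 : R)]).
pose q (n : nat) : R := n.+1%:R^-1.
have q0 n : 0 < q n by rewrite invr_gt0.
have /choice[p hp] : forall n, exists p : {poly R},
    forall t, 0 <= t <= M -> `|p.[t] - f t| <= q n.
  by move=> n; exact: hf.
have hpm m n x : nr (poly_op (p m) T x - poly_op (p n) T x) <= (q m + q n) * nr x.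
  rewrite -poly_opB; apply: nr_poly_op => //; first by rewrite addr_ge0 // ltW.
  move=> t /spec_itv ht; rewrite hornerD hornerN.
  have := hp m t ht; have := hp n t ht.
  by rewrite !ler_norml => /andP[? ?] /andP[? ?]; apply/andP; split; lra.
have /choice[S hS] : forall x, exists l, forall e : R, 0 < e ->
    exists N, forall n, (N <= n)%N -> nr (l - poly_op (p n) T x) <= e.
  move=> x; apply: nr_complete => e e0.
  have e1 : 0 < e / (nr x + 1) / 2 by rewrite !divr_gt0 // ltr_wpDl // nr_ge0.
  have [N hN] := natSinv_le e1; exists N => m n Nm Nn.
  apply: le_trans (hpm m n x) _.
  have h : q m + q n <= e / (nr x + 1).
    have qm : q m <= _ := hN _ Nm; have qn : q n <= _ := hN _ Nn.
    by rewrite [leRHS]splitr lerD.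
  apply: le_trans (ler_wpM2r (nr_ge0 x) h) _.
  rewrite mulrAC ler_pdivrMr ?ltr_wpDl ?nr_ge0 // ler_wpM2l ?lerDl //.
  exact: ltW.
have hSn n x : nr (S x - poly_op (p n) T x) <= q n * nr x.
  apply: (@le_of_eps _ _ _ (1 + nr x)) => [|e e0]; first by rewrite addr_ge0 ?nr_ge0.
  have [N hN] := hS x _ e0; have [N' hN'] := natSinv_le e0.
  pose m := maxn N N'; have h1 := hN m (leq_maxl _ _).
  have h2 : q m <= e by exact: hN' (leq_maxr _ _).
  have h3 := hpm m n x.
  have h4 := nrD (S x - poly_op (p m) T x) (poly_op (p m) T x - poly_op (p n) T x).
  move: h4; rewrite addrA subrK => h4.
  have h5 := ler_wpM2r (nr_ge0 x) h2.
  by rewrite mulrDl mul1r; move: h5 h3 h4 h1; rewrite mulrDl; lra.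
have bp n := bop_poly_op (p n) bT.
have lS : linear S.
  move=> a x y; apply/eqP; rewrite -subr_eq0; apply/eqP/nr0_eq0/eqP.
  rewrite eq_le nr_ge0 andbT.
  pose b := complex.Re `|a|.
  have b0 : 0 <= b by rewrite -ler0c RRe_real ?normr_ge0 // realE normr_ge0.
  apply: (@le_of_eps _ _ _ (nr (a *: x + y) + b * nr x + nr y)) => [|e e0].
    by rewrite !addr_ge0 ?mulr_ge0 ?nr_ge0.
  have [N hN] := natSinv_le e0; have qe : q N <= e by exact: hN.
  have -> : S (a *: x + y) - (a *: S x + S y) =
      (S (a *: x + y) - poly_op (p N) T (a *: x + y))
      - a *: (S x - poly_op (p N) T x) - (S y - poly_op (p N) T y).
    by apply: rin_ext => z; rewrite (bopL (bp N)) scalerBr !rinE; ring.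
  rewrite add0r; apply: le_trans (nrB _ _) _.
  have := nrB (S (a *: x + y) - poly_op (p N) T (a *: x + y)) (a *: (S x - poly_op (p N) T x)).
  rewrite nrZ_Re -/b; have := hSn N x; have := hSn N y; have := hSn N (a *: x + y).
  have h (x' : H) := ler_wpM2r (nr_ge0 x') qe.
  have := h x; have := h y; have := h (a *: x + y) => g1 g2 g3 g4 g5 g6 g7.
  have := ler_wpM2l b0 (le_trans g6 g3); move: g1 g2 g4 g5 g7.
  set z := a *: x + y; lra.
have bS : bounded_op S.
  have [K K0 hK] := bop_bound (bp 0%N).
  apply: (@bounded_opI _ _ _ _ (K + 1)) => // x.
  have := nrD (S x - poly_op (p 0%N) T x) (poly_op (p 0%N) T x).
  have := hSn 0%N x; rewrite /q invr1 subrK => h1 h2; have := hK x; lra.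
exists S; split => //; exists p; split.
  apply/uniform_cvgP => e e0; have [N hN] := natSinv_le e0; exists N => n Nn t ht.
  exact: le_trans (hp n t (spec_itv ht)) (hN _ Nn).
apply/cvgrPdist_le => e e0; have [N hN] := natSinv_le e0; exists N => // n /= Nn.
rewrite sub0r normrN ger0_norm; last by apply: opnorm_ge0; exact: bop_sub.
apply: le_trans (hN _ Nn); apply: opnorm_le; first exact/ltW/q0.
by move=> x /=; rewrite nrBC hSn.
Qed.

Lemma bop_cfc : bounded_op (cfc f T).
Proof. by case: cfcP. Qed.

(** The sequence of polynomials behind the chosen [cfc f T] is unknown; by
    [nr_poly_op] any polynomial close to f on the spectrum may replace it. This
    is the interface through which [cfc] is used from here on. *)
Lemma cfc_approx (p : {poly R}) e : 0 <= e ->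
  (forall t : R, spectrum T t%:C -> `|p.[t] - f t| <= e) ->
  forall x, nr (poly_op p T x - cfc f T x) <= e * nr x.
Proof.
move=> e0 hp x; have [bS [q [/uniform_cvgP hu /cvgrPdist_le hn]]] := cfcP.
apply: (@le_of_eps _ _ _ (2 * nr x)) => [|d d0]; first by rewrite mulr_ge0 ?nr_ge0.
have [N hN] := hu d d0; have [N' _ hN'] := hn d d0.
pose n := maxn N N'; have {hN} h1 := hN n (leq_maxl _ _).
have := hN' n (leq_maxr _ _); rewrite sub0r normrN.
have bq := bop_poly_op (q n) bT.
rewrite ger0_norm; last by apply: opnorm_ge0; exact: bop_sub.
move=> h2; have h3 := nr_opnorm x (bop_sub bq bS).
have h4 : nr (poly_op (p - q n) T x) <= (e + d) * nr x.
  apply: nr_poly_op => // [|t ht]; first by rewrite addr_ge0 // ltW.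
  have := h1 t ht; have := hp t ht; rewrite hornerD hornerN !ler_norml.
  by move=> /andP[? ?] /andP[? ?]; apply/andP; split; lra.
have := nrD (poly_op (p - q n) T x) (poly_op (q n) T x - cfc f T x).
rewrite {1}poly_opB addrA subrK; move: h3 h4 => /= h3 h4.
have := ler_wpM2r (nr_ge0 x) h2; move: h3 h4; lra.
Qed.

Lemma cfc_exists_approx e : 0 < e -> exists p : {poly R},
  (forall t : R, 0 <= t <= M -> `|p.[t] - f t| <= e) /\
  forall x, nr (poly_op p T x - cfc f T x) <= e * nr x.
Proof.
move=> e0; have [p hp] := hf e0; exists p; split => //.
by apply: cfc_approx; [exact: ltW|move=> t /spec_itv; exact: hp].
Qed.

Lemma selfadj_cfc : selfadj (cfc f T).
Proof.
split=> [|x y]; first exact: bop_cfc.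
have half a b : rin (cfc f T a) b <= rin a (cfc f T b).
  apply: (@le_of_eps _ _ _ (2 * (nr a * nr b))) => [|e e0].
    by rewrite !mulr_ge0 ?nr_ge0.
  have [p [_ hp]] := cfc_exists_approx e0.
  have [_ sp] := selfadj_poly_op p sT.
  have := rin_le (cfc f T a - poly_op p T a) b.
  have := rin_le a (poly_op p T b - cfc f T b).
  rewrite !rinE sp nrBC.
  have := ler_wpM2l (nr_ge0 a) (hp b); have := ler_wpM2r (nr_ge0 b) (hp a).
  rewrite (nrBC (cfc f T a)) (nrBC (cfc f T b)). lra.
by apply/eqP; rewrite eq_le half [leLHS]rinC [leRHS]rinC half.
Qed.

(** Order preservation against a polynomial minorant; with q = 0 it gives
    positivity, and with q affine it gives Jensen's inequality. *)
Lemma cfc_ge (q : {poly R}) : (forall t, 0 <= t <= M -> q.[t] <= f t) ->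
  forall x, rin (poly_op q T x) x <= rin (cfc f T x) x.
Proof.
move=> hq x; apply: (@le_of_eps _ _ _ (2 * nr x ^+ 2)) => [|e e0].
  by rewrite mulr_ge0 ?sqr_ge0.
have [p [pf hp]] := cfc_exists_approx e0.
have h1 := rin_le (poly_op p T x - cfc f T x) x.
have h2 : - e * nr x ^+ 2 <= rin (poly_op (p - q) T x) x.
  apply: poly_op_ge => // t /spec_itv ht; rewrite hornerD hornerN.
  have := hq _ ht; have := pf _ ht; rewrite ler_norml => /andP[]; lra.
move: h1 h2; rewrite poly_opB !rinE => h1 h2.
have := ler_wpM2r (nr_ge0 x) (hp x); rewrite expr2 in h2 *; lra.
Qed.

End Cfc.

(** * Bernstein approximation *)

Section Bernstein.
Context {R : realType}.
Implicit Types (g h : nat -> R) (Y : {poly R}).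

(** The Bernstein operator, with the values of g at 0, ..., n as node values: the
    expectation of g at a binomial variable with n trials and success
    probability Y, computed by conditioning on the first trial. *)
Fixpoint bernstein Y n g : {poly R} :=
  if n is n'.+1 then Y * bernstein Y n' (g \o S) + (1 - Y) * bernstein Y n' g
  else (g 0%N)%:P.

Lemma bernstein_le Y n g h t : 0 <= Y.[t] <= 1 ->
  (forall k, (k <= n)%N -> g k <= h k) -> (bernstein Y n g).[t] <= (bernstein Y n h).[t].
Proof.
move=> /andP[y0 y1]; elim: n g h => [|n IH] g h gh /=.
  by rewrite !hornerC gh.
rewrite !hornerE lerD // ler_wpM2l ?subr_ge0 // IH // => k kn.
  exact: gh.
by apply: gh; exact: leqW.
Qed.

(** Variance plus squared bias for the binomial law. The centre c has to be
    arbitrary because conditioning on the first trial shifts it. *)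
Lemma bernstein_sqr Y n t (a b c : R) :
  (bernstein Y n (fun k => a + b * (k%:R - c) ^+ 2)).[t] =
  a + b * (n%:R * Y.[t] * (1 - Y.[t]) + (n%:R * Y.[t] - c) ^+ 2).
Proof.
elim: n c => [|n IH] c /=; first by rewrite hornerC; ring.
have -> : (fun k => a + b * (k%:R - c) ^+ 2) \o S =
    (fun k => a + b * (k%:R - (c - 1)) ^+ 2).
  by apply/funext => k /=; rewrite -natr1; ring.
by rewrite !hornerE !IH -natr1; ring.
Qed.

(** The modulus of continuity is given in a quadratic form, so that the error of
    the Bernstein polynomial is bounded by the variance of the binomial law. The
    square root and Orlicz functions satisfy it with an explicit K. *)
Lemma bernstein_approx (f : R -> R) (M : R) : 0 < M ->
  (forall e, 0 < e -> exists2 K, 0 <= K & forall s t, 0 <= s <= M -> 0 <= t <= M ->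
     `|f s - f t| <= e + K * (s - t) ^+ 2) ->
  poly_approx f M.
Proof.
move=> M0 hf e e0; have e20 : 0 < e / 2 by rewrite divr_gt0.
have [K K0 hK] := hf _ e20.
have c0 : 0 < e / 2 / (K * M ^+ 2 + 1).
  by rewrite divr_gt0 // ltr_wpDl // mulr_ge0 // sqr_ge0.
have [N hN] := natSinv_le c0; pose n : R := N.+1%:R.
have n0 : 0 < n by rewrite ltr0n.
pose Y : {poly R} := M^-1 *: 'X.
exists (bernstein Y N.+1 (fun k => f (M / n * k%:R))) => t /andP[t0 tM].
have Yt : Y.[t] = t / M by rewrite /Y !hornerE mulrC.
have Y01 : 0 <= Y.[t] <= 1.
  by rewrite Yt divr_ge0 ?(ltW M0) //= ler_pdivrMr // mul1r.
have node k : (k <= N.+1)%N -> 0 <= M / n * k%:R <= M.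
  move=> kn; rewrite mulr_ge0 ?divr_ge0 ?(ltW M0) ?(ltW n0) //=.
  by rewrite mulrAC ler_pdivrMr // ler_wpM2l ?(ltW M0) // ler_nat.
have hk k : (k <= N.+1)%N -> `|f (M / n * k%:R) - f t| <=
    e / 2 + K * (M / n) ^+ 2 * (k%:R - n * (t / M)) ^+ 2.
  move=> kn; have := hK _ t (node k kn); rewrite t0 tM => /(_ isT).
  congr (_ <= _ + _); field.
  by rewrite !gt_eqF.
(* At the centre n t / M the second moment is n y (1 - y), which is at most n. *)
have err : K * (M / n) ^+ 2 * (n * Y.[t] * (1 - Y.[t]) + (n * Y.[t] - n * (t / M)) ^+ 2)
    <= e / 2.
  rewrite {3}Yt subrr expr0n addr0; set y := Y.[t] in Y01 *.
  case/andP: Y01 => y0 y1.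
  have yy : y * (1 - y) <= 1 by nra.
  rewrite (_ : _ * _ = K * M ^+ 2 * n^-1 * (y * (1 - y))); last first.
    by field; rewrite gt_eqF.
  have h1 : 0 <= K * M ^+ 2 * n^-1.
    by apply: mulr_ge0; [apply: mulr_ge0 => //; exact: sqr_ge0|rewrite invr_ge0 ltW].
  apply: le_trans (ler_wpM2l h1 yy) _; rewrite mulr1.
  have h2 : 0 <= K * M ^+ 2 by rewrite mulr_ge0 // sqr_ge0.
  apply: le_trans (ler_wpM2l h2 (hN N (leqnn N))) _.
  rewrite mulrCA ler_piMr ?(ltW e20) // ler_pdivrMr ?mul1r ?lerDl //.
  exact: ltr_wpDl.
set V := K * (M / n) ^+ 2 in hk err.
have lo k : (k <= N.+1)%N ->
    f t - e / 2 + (- V) * (k%:R - n * (t / M)) ^+ 2 <= f (M / n * k%:R).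
  move=> kn; have := hk k kn; rewrite ler_norml mulNr => /andP[+ _].
  by move: (V * _) => v; lra.
have hi k : (k <= N.+1)%N ->
    f (M / n * k%:R) <= f t + e / 2 + V * (k%:R - n * (t / M)) ^+ 2.
  move=> kn; have := hk k kn; rewrite ler_norml => /andP[_].
  by move: (V * _) => v; lra.
have := bernstein_le Y01 lo; have := bernstein_le Y01 hi.
rewrite !bernstein_sqr -/n ler_norml; move: err; rewrite mulNr.
by move: (V * _) => v h1 h2 h3; apply/andP; split; lra.
Qed.

Lemma poly_approx_sqrt (M : R) : 0 < M -> poly_approx Num.sqrt M.
Proof.
move=> M0; apply: bernstein_approx => // e e0; exists (e ^+ 3)^-1.
  by rewrite invr_ge0 exprn_ge0 // ltW.
move=> s t /andP[s0 _] /andP[t0 _].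
set a := Num.sqrt s; set b := Num.sqrt t.
have a0 : 0 <= a by exact: sqrtr_ge0.
have b0 : 0 <= b by exact: sqrtr_ge0.
have -> : s = a ^+ 2 by rewrite sqr_sqrtr.
have -> : t = b ^+ 2 by rewrite sqr_sqrtr.
set d := `|a - b|.
have d0 : 0 <= d by exact: normr_ge0.
have d4 : d ^+ 4 <= (a ^+ 2 - b ^+ 2) ^+ 2.
  have -> : d ^+ 4 = (a - b) ^+ 2 * (a - b) ^+ 2.
    by rewrite -(real_normK (num_real (a - b))) -/d -exprD.
  rewrite subr_sqr exprMn ler_wpM2l ?sqr_ge0 //.
  by have := mulr_ge0 a0 b0; rewrite sqrrB sqrrD; lra.
have [de|ed] := leP d e.
  by rewrite ler_wpDr // mulr_ge0 ?sqr_ge0 // invr_ge0 exprn_ge0 // ltW.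
have h : d <= (e ^+ 3)^-1 * d ^+ 4.
  rewrite ler_pdivlMl ?exprn_gt0 // [leRHS]exprSr ler_wpM2r //.
  by rewrite lerXn2r ?nnegrE // ltW.
apply: le_trans h _; rewrite ler_wpDl ?(ltW e0) // ler_wpM2l //.
by rewrite invr_ge0 exprn_ge0 // ltW.
Qed.

End Bernstein.

(** * Orlicz functions *)

Section Orlicz.
Context {R : realType}.
Variables (phi : R -> R) (ophi : orlicz phi).

Lemma orlicz_mono u v : 0 <= u -> u <= v -> phi u <= phi v.
Proof.
move=> u0 uv; apply: (orlicz_nondecreasing ophi) => //.
  by rewrite in_itv /= u0.
by rewrite in_itv /= (le_trans u0).
Qed.

Lemma orlicz_conv (x y t : R) : 0 <= x -> 0 <= y -> 0 <= t <= 1 ->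
  phi (t * x + (1 - t) * y) <= t * phi x + (1 - t) * phi y.
Proof.
move=> x0 y0 /andP[t0 t1].
have mem z : 0 <= z -> z \in (`[0, +oo[%classic : set R).
  by move=> z0; rewrite inE /= in_itv /= z0.
by have := orlicz_convex ophi (Itv01 t0 t1) (mem _ x0) (mem _ y0); rewrite !convRE.
Qed.

Lemma orlicz_slope (x y z : R) : 0 <= x -> x <= y -> y <= z ->
  phi y * (z - x) <= phi x * (z - y) + phi z * (y - x).
Proof.
move=> x0 xy yz.
have [xz|zx] := ltP x z; last first.
  have -> : y = x by apply/eqP; rewrite eq_le xy (le_trans yz).
  have -> : z = x by apply/eqP; rewrite eq_le zx (le_trans xy).
  by rewrite !subrr !mulr0 addr0.
have d0 : 0 < z - x by rewrite subr_gt0.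
have := @orlicz_conv x z ((z - y) / (z - x)) x0 (le_trans x0 (ltW xz)).
rewrite divr_ge0 ?subr_ge0 ?(ltW xz) //= ler_pdivrMr // mul1r lerD2l lerN2 xy.
move=> /(_ isT); set p := (z - y) / (z - x).
have e1 : p * x + (1 - p) * z = y by rewrite /p; field; rewrite gt_eqF.
have e2 : p * (z - x) = z - y by rewrite /p divfK ?gt_eqF.
have e3 : (1 - p) * (z - x) = y - x by rewrite mulrBl mul1r e2; ring.
rewrite e1 -(ler_pM2r d0) mulrDl -mulrA (mulrC (phi x)) mulrA e2.
rewrite (mulrAC (1 - p)) e3; lra.
Qed.

(** By the three-slope inequality the slope on [s, t] is at most the slope on
    [t, M + 1], whose length is at least 1. *)
Lemma orlicz_lipschitz (M s t : R) : 0 <= s -> s <= t -> t <= M ->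
  phi t - phi s <= phi (M + 1) * (t - s).
Proof.
move=> s0 st tM.
have t0 := le_trans s0 st; have M0 := le_trans t0 tM.
have tM1 : t <= M + 1 by lra.
have h := orlicz_slope s0 st tM1.
have ps := orlicz_ge0 ophi s0.
have hm : phi s <= phi t by exact: orlicz_mono.
have hM : 0 <= phi (M + 1) by apply: (orlicz_ge0 ophi); lra.
have d1 : 1 <= M + 1 - t by lra.
have : (phi t - phi s) * 1 <= (phi t - phi s) * (M + 1 - t).
  by rewrite ler_wpM2l // subr_ge0.
have : 0 <= phi t * (t - s) by rewrite mulr_ge0 ?subr_ge0 // (le_trans ps).
lra.
Qed.

Lemma poly_approx_orlicz (M : R) : 0 < M -> poly_approx phi M.
Proof.
move=> M0; apply: bernstein_approx => // e e0.
set L := phi (M + 1); exists (L ^+ 2 / (4 * e)).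
  by rewrite divr_ge0 ?sqr_ge0 // mulr_ge0 // ltW.
have key d : L * d <= e + L ^+ 2 / (4 * e) * d ^+ 2.
  rewrite -subr_ge0 (_ : _ - _ = (2 * e - L * d) ^+ 2 / (4 * e)).
    by rewrite divr_ge0 ?sqr_ge0 // mulr_ge0 // ltW.
  by field; rewrite gt_eqF.
move=> s t; wlog st : s t / s <= t.
  move=> h hs ht; have [st|ts] := leP s t; first exact: h.
  rewrite distrC (_ : (s - t) ^+ 2 = (t - s) ^+ 2); last by ring.
  by apply: h => //; exact: ltW.
move=> /andP[s0 sM] /andP[t0 tM].
rewrite distrC ger0_norm ?subr_ge0 ?orlicz_mono //.
apply: le_trans (orlicz_lipschitz s0 st tM) _; rewrite -/L.
by rewrite (_ : (s - t) ^+ 2 = (t - s) ^+ 2) ?key //; ring.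
Qed.

(** A supporting line at t0 > 0 has the supremum of the slopes to the left of t0
    as its slope; at 0 the horizontal line is one. *)
Lemma orlicz_support (t0 : R) : 0 <= t0 ->
  exists c, forall t, 0 <= t -> phi t0 + c * (t - t0) <= phi t.
Proof.
rewrite le_eqVlt => /predU1P[<-|t0p].
  by exists 0 => t t1; rewrite mul0r addr0 orlicz_mono.
pose slope s := (phi t0 - phi s) / (t0 - s).
pose E := [set slope s | s in [set s | 0 <= s < t0]].
have up z : t0 < z -> ubound E ((phi z - phi t0) / (z - t0)).
  move=> tz _ [s /= /andP[s0 st] <-].
  have := orlicz_slope s0 (ltW st) (ltW tz).
  rewrite /slope ler_pdivrMr ?subr_gt0 // mulrAC ler_pdivlMr ?subr_gt0 //; lra.
have E0 : E (slope 0) by exists 0 => //=; rewrite lexx.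
have t1 : t0 < t0 + 1 by rewrite ltrDl.
exists (sup E) => t tp; have [tt|tt|->] := ltgtP t t0; last first.
- by rewrite subrr mulr0 addr0.
- have : sup E <= (phi t - phi t0) / (t - t0).
    by apply: ge_sup; [exists (slope 0)|exact: up].
  by rewrite ler_pdivlMr ?subr_gt0 //; lra.
have : slope t <= sup E.
  apply: ub_le_sup; last by exists t => //=; rewrite tp.
  by exists ((phi (t0 + 1) - phi t0) / (t0 + 1 - t0)); exact: up.
by rewrite /slope ler_pdivrMr ?subr_gt0 //; lra.
Qed.

End Orlicz.

(** * The Hilbert sum of two copies of a space *)

Section HilbertSum.
Context {R : realType} {H : hilbertType R}.
Implicit Types (A B C D : H -> H) (u v : hsum H H).

Lemma rin_hsum u v : rin u v = rin u.1 v.1 + rin u.2 v.2.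
Proof. by rewrite /rin /= raddfD. Qed.

Lemma nr_hsum u : nr u ^+ 2 = nr u.1 ^+ 2 + nr u.2 ^+ 2.
Proof. by rewrite -!rinxx rin_hsum. Qed.

Lemma nr_hsum_le u : nr u <= nr u.1 + nr u.2.
Proof.
rewrite -(@ler_pXn2r _ 2) ?nnegrE ?addr_ge0 ?nr_ge0 // nr_hsum sqrrD.
by have := mulr_ge0 (nr_ge0 u.1) (nr_ge0 u.2); lra.
Qed.

Lemma nr_hsum1 u : nr u.1 <= nr u.
Proof.
by rewrite -(@ler_pXn2r _ 2) ?nnegrE ?nr_ge0 // nr_hsum lerDl sqr_ge0.
Qed.

Lemma nr_hsum2 u : nr u.2 <= nr u.
Proof.
by rewrite -(@ler_pXn2r _ 2) ?nnegrE ?nr_ge0 // nr_hsum lerDr sqr_ge0.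
Qed.

Lemma bop_opmx A B C D : bounded_op A -> bounded_op B -> bounded_op C ->
  bounded_op D -> bounded_op (opmx A B C D).
Proof.
move=> bA bB bC bD.
have [a a0 ha] := bop_bound bA; have [b b0 hb] := bop_bound bB.
have [c c0 hc] := bop_bound bC; have [d d0 hd] := bop_bound bD.
apply: (@bounded_opI _ _ _ _ (a + b + (c + d))) => [z u v|u].
  rewrite /opmx /= (bopL bA) (bopL bB) (bopL bC) (bopL bD).
  by congr (_, _); rewrite addrACA -scalerDr.
apply: le_trans (nr_hsum_le _) _.
rewrite mulrDl lerD // /opmx /=; apply: le_trans (nrD _ _) _; rewrite mulrDl lerD //.
- by apply: le_trans (ha _) _; rewrite ler_pM2l ?nr_hsum1.
- by apply: le_trans (hb _) _; rewrite ler_pM2l ?nr_hsum2.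
- by apply: le_trans (hc _) _; rewrite ler_pM2l ?nr_hsum1.
- by apply: le_trans (hd _) _; rewrite ler_pM2l ?nr_hsum2.
Qed.

(** A diagonal operator matrix has its polynomials computed blockwise, so that
    the square of an off-diagonal self-adjoint matrix carries the functional
    calculus of both of its blocks. *)
Lemma poly_op_diag (p : {poly R}) A D u :
  poly_op p (opmx A (\0) (\0) D) u = (poly_op p A u.1, poly_op p D u.2).
Proof.
elim/poly_ind: p u => [|p a IH] u.
  by rewrite !poly_opC !scale0r.
by rewrite !poly_opD !poly_opMX !poly_opC IH /opmx /= addr0 add0r.
Qed.

End HilbertSum.

(** * Absolute values, the mixed Schwarz inequality and Jensen's inequality *)

Section Pos.
Context {R : realType} {H : hilbertType R}.
Implicit Types (A T : H -> H) (x y : H).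

Lemma le_of_small_eps (a b k : R) : 0 <= k ->
  (forall e : R, 0 < e <= 1 -> a <= b + k * e) -> a <= b.
Proof.
move=> k0 h; apply: (le_of_eps k0) => e e0; have [e1|e1] := leP e 1.
  by apply: h; rewrite e0.
have := h 1; rewrite ltr01 lexx => /(_ isT) h1.
by have := ler_wpM2l k0 (ltW e1); lra.
Qed.

Definition posop T : Prop := selfadj T /\ forall x, 0 <= rin (T x) x.

Lemma posop_bound T : posop T ->
  exists2 M : R, 0 < M & forall x, 0 <= rin (T x) x <= M * nr x ^+ 2.
Proof.
move=> [[bT sT] pT]; have [M M0 hM] := bop_bound bT; exists M => // x.
rewrite pT; apply: le_trans (rin_le _ _) _.
by rewrite expr2 mulrA ler_wpM2r ?nr_ge0.
Qed.

Lemma rin_adjcomp A x y : bounded_op A ->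
  rin ((adjoint A \o A) x) y = rin (A x) (A y).
Proof. by move=> bA; rewrite /= rinC -rin_adj // rinC. Qed.

Lemma posop_adjcomp A : bounded_op A -> posop (adjoint A \o A).
Proof.
move=> bA; split=> [|x]; last by rewrite rin_adjcomp // rinxx sqr_ge0.
split=> [|x y]; first by apply: bop_comp => //; exact: adjoint_bop.
by rewrite rin_adjcomp // [RHS]rinC rin_adjcomp // rinC.
Qed.

Lemma posop_absop A : bounded_op A -> posop (absop A).
Proof.
move=> bA; have pT := posop_adjcomp bA; have [M M0 hM] := posop_bound pT.
have hs := poly_approx_sqrt M0; split; first exact: selfadj_cfc pT.1 hM hs.
move=> x; have := @cfc_ge _ _ _ _ _ pT.1 hM hs 0%:P _ x.
by rewrite poly_opC scale0r rin0l; apply => t _; rewrite hornerC sqrtr_ge0.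
Qed.

(** In other words |A|^2 and adj(A) A have the same form: a polynomial close to
    the square root on [0, M] has its square close to the identity there. *)
Lemma nr_absop A x : bounded_op A -> nr (absop A x) = nr (A x).
Proof.
move=> bA; have pT := posop_adjcomp bA; have [M M0 hM] := posop_bound pT.
have hs := poly_approx_sqrt M0; have [bT _] := pT.1.
have bS : bounded_op (absop A) by case: (posop_absop bA) => -[].
apply/eqP; rewrite -(@eqrXn2 _ 2) ?nr_ge0 //; apply/eqP.
have [K K0 hK] := bop_bound bS.
have M1 : 0 <= Num.sqrt M by exact: sqrtr_ge0.
have key (e : R) : 0 < e <= 1 -> `|nr (absop A x) ^+ 2 - nr (A x) ^+ 2| <=
    (2 * Num.sqrt M + 1 + 2 * K + 1) * nr x ^+ 2 * e.
  move=> /andP[e0 e1]; have [p [pe hp]] := cfc_exists_approx pT.1 hM hs e0.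
  have h1 : `|nr (poly_op p (adjoint A \o A) x) ^+ 2 - nr (A x) ^+ 2| <=
      (2 * Num.sqrt M + 1) * e * nr x ^+ 2.
    have -> : nr (poly_op p (adjoint A \o A) x) ^+ 2 - nr (A x) ^+ 2 =
        rin (poly_op (p * p - 'X) (adjoint A \o A) x) x.
      rewrite poly_opB poly_opM // poly_opX rinDl rinNl rin_adjcomp // rinxx.
      by rewrite (selfadj_poly_op p pT.1).2 rinxx.
    have hq (t : R) : spectrum (adjoint A \o A) t%:C ->
        `|(p * p - 'X).[t]| <= (2 * Num.sqrt M + 1) * e.
      move=> /(spectrum_itv (m := 0) (M := M) pT.1).
      rewrite (_ : _ .[t] = p.[t] ^+ 2 - t); last by rewrite !hornerE.
      move=> /(_ _)/wrap[y|/andP[t0 tM]]; first by rewrite mul0r.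
      have := pe t; rewrite t0 tM => /(_ isT).
      rewrite -{4}(sqr_sqrtr t0).
      have : Num.sqrt t <= Num.sqrt M by exact: ler_wsqrtr.
      have := sqrtr_ge0 t; move: (Num.sqrt t) => s s0 sM.
      rewrite subr_sqr normrM => h.
      have h' : `|p.[t] + s| <= 2 * Num.sqrt M + 1.
        have -> : p.[t] + s = (p.[t] - s) + 2 * s by ring.
        apply: le_trans (ler_normD _ _) _.
        by rewrite (@ger0_norm _ (2 * s)) ?mulr_ge0 //; lra.
      by rewrite mulrC ler_pM.
    rewrite ler_norml; apply/andP; split.
      rewrite -mulNr; apply: poly_op_ge; first exact: pT.1.
      by move=> t /hq; rewrite ler_norml => /andP[].
    apply: poly_op_le; first exact: pT.1.
    by move=> t /hq; rewrite ler_norml => /andP[].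
  have h2 : `|nr (absop A x) ^+ 2 - nr (poly_op p (adjoint A \o A) x) ^+ 2| <=
      (2 * K + 1) * e * nr x ^+ 2.
    have := hp x; have := hK x; rewrite -/(absop A).
    set a := absop A x; set b := poly_op _ _ x => ha hb.
    have := nrD (b - a) a; rewrite subrK => hc.
    have hd : `|nr a - nr b| <= e * nr x.
      have := nrD (a - b) b; rewrite subrK nrBC => hd'.
      by rewrite ler_norml; apply/andP; split; lra.
    rewrite subr_sqr normrM (ger0_norm (addr_ge0 (nr_ge0 _) (nr_ge0 _))).
    have -> : (2 * K + 1) * e * nr x ^+ 2 = e * nr x * ((2 * K + 1) * nr x) by ring.
    rewrite ler_pM ?normr_ge0 ?addr_ge0 ?nr_ge0 //.
    by have := ler_wpM2r (nr_ge0 x) e1; lra.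
  have := ler_normD (nr (absop A x) ^+ 2 - nr (poly_op p (adjoint A \o A) x) ^+ 2)
    (nr (poly_op p (adjoint A \o A) x) ^+ 2 - nr (A x) ^+ 2).
  rewrite addrA subrK; lra.
have k0 : 0 <= (2 * Num.sqrt M + 1 + 2 * K + 1) * nr x ^+ 2.
  by rewrite mulr_ge0 ?sqr_ge0 // !addr_ge0 ?mulr_ge0 // ltW.
apply/eqP; rewrite eq_le; apply/andP; split; apply: (le_of_small_eps k0) => e /key;
  rewrite ler_norml => /andP[]; lra.
Qed.

Lemma rin_unitZ (a : R[i]) x y : `|a| = 1 -> rin (a *: x) (a *: y) = rin x y.
Proof.
move=> a1; rewrite /rin innerZl innerZr mulrA.
by rewrite -normCK a1 expr1n mul1r.
Qed.

(** Let N be the self-adjoint operator matrix with off-diagonal blocks adj(A) and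
    A. Then N^2 is diagonal with blocks adj(A) A and A adj(A), so |N| is diagonal
    with blocks |A| and |adj(A)|; the claim is N <= |N| at the vector (x, y).
    Using N avoids the polar decomposition of A. *)
Lemma mixed_schwarz_rin A x y : bounded_op A ->
  2 * rin (A x) y <= rin (absop A x) x + rin (absop (adjoint A) y) y.
Proof.
move=> bA; have bA' := adjoint_bop bA; have b0 := @bop_null R H H.
pose N := opmx (\0) (adjoint A) A (\0).
have bN : bounded_op N by exact: bop_opmx.
have sN : selfadj N.
  split=> // u v; rewrite !rin_hsum /N /opmx /= !add0r !addr0.
  rewrite (rinC (adjoint A _)) -!(rin_adj _ _ bA) addrC.
  by rewrite (rinC (A v.1)).
have [L L0 hL] := bop_bound bN.
have NN : N \o N = opmx (adjoint A \o A) (\0) (\0) (A \o adjoint A).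
  by apply/funext => u; rewrite /N /opmx /= !add0r !addr0.
have itvN (t : R) : spectrum N t%:C -> - L <= t <= L.
  apply: spectrum_itv => // u; rewrite mulNr -ler_norml.
  apply: le_trans (cauchy_schwarz _ _) _.
  by rewrite expr2 mulrA ler_wpM2r ?nr_ge0.
have p1 := posop_adjcomp bA; have [M1 M10 hM1] := posop_bound p1.
have p2 := posop_adjcomp bA'; rewrite adjointK // in p2.
have [M2 M20 hM2] := posop_bound p2.
pose M := L ^+ 2 + M1 + M2; have L2 : 0 <= L ^+ 2 by exact: sqr_ge0.
have M0 : 0 < M by rewrite /M; lra.
have hT1 z : 0 <= rin ((adjoint A \o A) z) z <= M * nr z ^+ 2.
  have /andP[-> h] := hM1 z; apply: le_trans h _; rewrite ler_wpM2r ?sqr_ge0 //.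
  by rewrite /M; lra.
have hT2 z : 0 <= rin ((A \o adjoint A) z) z <= M * nr z ^+ 2.
  have /andP[-> h] := hM2 z; apply: le_trans h _; rewrite ler_wpM2r ?sqr_ge0 //.
  by rewrite /M; lra.
have hs := poly_approx_sqrt M0.
have spec1 := cfc_approx p1.1 hT1 hs; have spec2 := cfc_approx p2.1 hT2 hs.
pose u : hsum H H := (x, y).
apply: (@le_of_eps _ _ _ (2 * (nr x ^+ 2 + nr y ^+ 2))) => [|e e0].
  by rewrite mulr_ge0 ?addr_ge0 ?sqr_ge0.
have [p pe] := hs _ e0.
have itv_le T t : selfadj T -> (forall z, 0 <= rin (T z) z <= M * nr z ^+ 2) ->
    spectrum T t%:C -> `|p.[t] - Num.sqrt t| <= e.
  move=> sT hT st; apply: pe; apply: (spectrum_itv sT _ st) => z.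
  by rewrite mul0r; exact: hT.
have h1 := spec1 p e (ltW e0) (fun t => itv_le _ t p1.1 hT1) x.
have h2 := spec2 p e (ltW e0) (fun t => itv_le _ t p2.1 hT2) y.
(* On the spectrum of N, p(t^2) is e-close to |t|, so p(t^2) - t >= - e. *)
have h3 : - e * nr u ^+ 2 <= rin (poly_op (p \Po 'X^2 - 'X) N u) u.
  apply: poly_op_ge => // t /itvN; rewrite -ler_norml => tL.
  rewrite !hornerE horner_comp hornerXn.
  have := pe (t ^+ 2); rewrite sqr_ge0 sqrtr_sqr => /(_ _)/wrap[|].
    rewrite -(real_normK (num_real t)) /M.
    have : `|t| ^+ 2 <= L ^+ 2 by rewrite lerXn2r ?nnegrE ?(ltW L0).
    lra.
  rewrite ler_norml => /andP[h _]; have := ler_norm t; lra.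
move: h3; rewrite poly_opB poly_op_comp_sqr // NN poly_op_diag poly_opX.
rewrite rin_hsum nr_hsum /N /opmx /u /= add0r addr0 !rinE.
rewrite (rinC (adjoint A y)) -(rin_adj _ _ bA).
have := rin_le (poly_op p (adjoint A \o A) x - absop A x) x.
have := rin_le (poly_op p (A \o adjoint A) y - absop (adjoint A) y) y.
have eS : absop (adjoint A) = cfc Num.sqrt (A \o adjoint A).
  by rewrite /absop adjointK.
move: h1 h2; rewrite -/(absop A) -eS => h1 h2.
have := ler_wpM2r (nr_ge0 x) h1; have := ler_wpM2r (nr_ge0 y) h2.
rewrite !rinE !expr2; lra.
Qed.

Lemma mixed_schwarz A x y : bounded_op A ->
  2 * ain (A x) y <= rin (absop A x) x + rin (absop (adjoint A) y) y.
Proof.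
move=> bA; have [a a1 <-] := ain_phase (A x) y.
have [bS _] := (posop_absop bA).1.
rewrite -(bopZ bA); apply: le_trans (mixed_schwarz_rin _ _ bA) _.
by rewrite (bopZ bS) rin_unitZ.
Qed.

Lemma absop_selfadj_ge A x : selfadj A -> `|rin (A x) x| <= rin (absop A x) x.
Proof.
move=> [bA sA]; have eA : adjoint A = A by exact: adjoint_eq.
have [bS _] := (posop_absop bA).1.
have h1 := mixed_schwarz_rin x x bA; have h2 := mixed_schwarz_rin x (- x) bA.
rewrite eA in h1 h2; rewrite (bopN bS) !rinE opprK in h2.
by rewrite ler_norml; apply/andP; split; lra.
Qed.

Lemma reop_selfadj A : bounded_op A -> selfadj (reop A).
Proof.
move=> bA; have bA' := adjoint_bop bA; split.
  exact: bop_scale (bop_add bA bA').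
have two : (2^-1 : R[i]) = (2^-1)%:C by rewrite fmorphV rmorph_nat.
move=> x y; rewrite /reop two !rinE (rinC (adjoint A x)).
by rewrite -!(rin_adj _ _ bA) (rinC (A y)) addrC.
Qed.

Lemma rin_reop A x : bounded_op A -> rin (reop A x) x = rin (A x) x.
Proof.
have two : (2^-1 : R[i]) = (2^-1)%:C by rewrite fmorphV rmorph_nat.
move=> bA; rewrite /reop two !rinE (rinC (adjoint A x)) -(rin_adj _ _ bA).
lra.
Qed.

Lemma posop_sqop T : posop T -> posop (sqop T).
Proof.
move=> [[bT sT] pT]; split; last by move=> x; rewrite /sqop /= sT rinxx sqr_ge0.
by split; [exact: bop_comp|move=> x y; rewrite /sqop /= !sT].
Qed.

Lemma rin_sqop_absop A x : bounded_op A ->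
  rin (sqop (absop A) x) x = nr (A x) ^+ 2.
Proof.
move=> bA; have [_ sT] := (posop_absop bA).1.
by rewrite /sqop /= sT rinxx nr_absop.
Qed.

Section Jensen.
Variables (phi : R -> R) (ophi : orlicz phi).

Lemma selfadj_cfc_orlicz T : posop T -> selfadj (cfc phi T).
Proof.
move=> pT; have [M M0 hM] := posop_bound pT.
exact: selfadj_cfc pT.1 hM (poly_approx_orlicz ophi M0).
Qed.

(** Affine minorants of phi pass to operators; a supporting line then yields
    Jensen's inequality. *)
Lemma cfc_orlicz_support T (a c : R) x : posop T ->
  (forall t, 0 <= t -> a + c * t <= phi t) ->
  a * nr x ^+ 2 + c * rin (T x) x <= rin (cfc phi T x) x.
Proof.
move=> pT h; have [M M0 hM] := posop_bound pT.
have := @cfc_ge _ _ _ _ _ pT.1 hM (poly_approx_orlicz ophi M0)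
  (a%:P + c%:P * 'X) _ x.
rewrite poly_opD poly_opMC poly_opC poly_opX !rinE rinxx; apply.
by move=> t /andP[t0 _]; rewrite !hornerE h.
Qed.

(** Jensen's inequality for the diagonal operator with blocks T1 and T2 at the unit
    vector (x1, x2), stated blockwise because the two blocks are given by
    separate functional calculi. *)
Lemma jensen2 T1 T2 x1 x2 : posop T1 -> posop T2 -> nr x1 ^+ 2 + nr x2 ^+ 2 = 1 ->
  phi (rin (T1 x1) x1 + rin (T2 x2) x2) <=
  rin (cfc phi T1 x1) x1 + rin (cfc phi T2 x2) x2.
Proof.
move=> pT1 pT2 x12; set t0 := _ + _.
have t00 : 0 <= t0 by rewrite addr_ge0 ?(pT1.2) ?(pT2.2).
have [c hc] := orlicz_support ophi t00.
have hc' t : 0 <= t -> (phi t0 - c * t0) + c * t <= phi t.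
  by move=> /hc; lra.
have := cfc_orlicz_support x1 pT1 hc'; have := cfc_orlicz_support x2 pT2 hc'.
have : (phi t0 - c * t0) * (nr x1 ^+ 2 + nr x2 ^+ 2) = phi t0 - c * t0.
  by rewrite x12 mulr1.
have : c * t0 = c * rin (T1 x1) x1 + c * rin (T2 x2) x2 by rewrite mulrDr.
lra.
Qed.

End Jensen.

Lemma rin_le_opnorm (K : hilbertType R) (D : K -> K) (x : K) : bounded_op D -> nr x = 1 ->
  rin (D x) x <= opnorm D.
Proof.
move=> bD x1; apply: le_trans (rin_le _ _) _.
by have := nr_opnorm x bD; rewrite x1 !mulr1.
Qed.

End Pos.

(** * The numerical radius *)

Section Numrad.
Context {R : realType} {H : hilbertType R}.
Variables (A : H -> H) (bA : bounded_op A).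

Let E := [set complex.Re `|inner (A x) x| | x in [set x : H | `|x| = 1]].

Let ubE : has_ubound E.
Proof.
have [M M0 hM] := bop_bound bA; exists M => _ [x /= x1 <-].
have nx1 : nr x = 1 by rewrite /nr x1.
by apply: le_trans (ain_le _ _) _; rewrite nx1 mulr1; have := hM x; rewrite nx1 mulr1.
Qed.

Lemma ain_le_numrad x : nr x = 1 -> ain (A x) x <= numrad A.
Proof.
by move=> x1; apply: ub_le_sup => //; exists x => //=; rewrite nrE x1.
Qed.

Lemma numrad_ge0 : 0 <= numrad A.
Proof.
have [[_ [x x1 _]]|E0] := pselect (E !=set0).
  by apply: le_trans (ain_le_numrad (x := x) _); [exact: ain_ge0|rewrite /nr x1].
by rewrite /numrad -/E (_ : E = set0) ?sup0 //; apply/nonemptyPn.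
Qed.

(** On the zero space there is no unit vector, and the numerical radius is 0. *)
Lemma numrad_approx : numrad A = 0 \/ forall e, 0 < e ->
  exists2 x, nr x = 1 & numrad A - e < ain (A x) x.
Proof.
have [E1|E0] := pselect (E !=set0); last first.
  by left; rewrite /numrad -/E (_ : E = set0) ?sup0 //; apply/nonemptyPn.
right=> e e0; have [_ [x /= x1 <-] h] := sup_adherent e0 (conj E1 ubE).
by exists x => //; rewrite /nr x1.
Qed.

End Numrad.

(** * The numerical radius of an off-diagonal operator matrix *)

Section Main.
Context {R : realType} {H : hilbertType R}.
Variables (P Q : H -> H) (bP : bounded_op P) (bQ : bounded_op Q).
Variables (phi : R -> R) (ophi : orlicz phi).

Let bP' : bounded_op (adjoint P) := adjoint_bop bP.
Let bQ' : bounded_op (adjoint Q) := adjoint_bop bQ.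
Let A := opmx (\0) P Q (\0).
Let b0 : bounded_op (\0 : H -> H) := @bop_null R H H.
Let bA : bounded_op A := bop_opmx b0 bP bQ b0.

Let bop_absop (B : H -> H) : bounded_op B -> bounded_op (absop B).
Proof. by move=> /posop_absop[[]]. Qed.

Let E1 (x : hsum H H) : R := nr (Q x.1) ^+ 2 + nr (P x.2) ^+ 2.
Let E2 (x : hsum H H) : R := nr (adjoint P x.1) ^+ 2 + nr (adjoint Q x.2) ^+ 2.
Let N1 := absop (reop (absop Q \o absop (adjoint P))).
Let N2 := absop (reop (absop P \o absop (adjoint Q))).
Let F (x : hsum H H) : R := rin (N1 x.1) x.1 + rin (N2 x.2) x.2.

(** The cross term of the square is 2 Re <|B| |C| x, x>, which is twice the form
    of the real part of |B| |C|. *)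
Lemma nr_absop_add_sqr (B C : H -> H) (x : H) : bounded_op B -> bounded_op C ->
  nr (absop B x + absop C x) ^+ 2 <=
  nr (B x) ^+ 2 + nr (C x) ^+ 2 + 2 * rin (absop (reop (absop B \o absop C)) x) x.
Proof.
move=> bB bC; have [_ sB] := (posop_absop bB).1.
have bBC := bop_comp (bop_absop bB) (bop_absop bC).
have := absop_selfadj_ge x (reop_selfadj bBC); rewrite ler_norml => /andP[_].
rewrite (rin_reop _ bBC) /= sB -rinxx !rinE !rinxx (nr_absop _ bB) (nr_absop _ bC).
rewrite (rinC (absop C x)).
move: (nr (B x)) (nr (C x)) (rin (absop B x) (absop C x)).
by move: (rin (absop _ x) x) => m b c k; lra.
Qed.

(** The mixed Schwarz inequality gives 2 |<A x, x>| <= <(|A| + |adj(A)|) x, x>,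
    and the right-hand side is at most the norm of (|A| + |adj(A)|) x. *)
Lemma ain_offdiag_le (x : hsum H H) : nr x = 1 ->
  ain (A x) x ^+ 2 <= 4^-1 * E1 x + 4^-1 * E2 x + 2^-1 * F x.
Proof.
move=> x1; pose S1 := absop Q \+ absop (adjoint P); pose S2 := absop P \+ absop (adjoint Q).
have tri : ain (A x) x <= ain (P x.2) x.1 + ain (Q x.1) x.2.
  rewrite -lecR rmorphD /= -!ainE /A /opmx /=.
  by apply: le_trans (ler_normD _ _); rewrite /= add0r addr0.
have h1 := mixed_schwarz x.2 x.1 bP; have h2 := mixed_schwarz x.1 x.2 bQ.
have h3 : rin (opmx S1 (\0) (\0) S2 x) x <= nr (opmx S1 (\0) (\0) S2 x).
  by have := rin_le (opmx S1 (\0) (\0) S2 x) x; rewrite x1 mulr1.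
have h4 : 2 * ain (A x) x <= nr (opmx S1 (\0) (\0) S2 x).
  apply: le_trans h3; rewrite rin_hsum /opmx /= addr0 add0r !rinE.
  move: tri h1 h2; move: (rin (absop P _) _) (rin (absop Q _) _).
  move: (rin (absop (adjoint P) _) _) (rin (absop (adjoint Q) _) _).
  by move: (ain (P _) _) (ain (Q _) _) (ain _ _) => *; lra.
have h5 : (2 * ain (A x) x) ^+ 2 <= nr (opmx S1 (\0) (\0) S2 x) ^+ 2.
  by rewrite lerXn2r ?nnegrE ?nr_ge0 ?mulr_ge0 ?ain_ge0.
move: h5; rewrite nr_hsum /opmx /= addr0 add0r.
have := nr_absop_add_sqr x.1 bQ bP'; have := nr_absop_add_sqr x.2 bP bQ'.
rewrite exprMn /E1 /E2 /F /N1 /N2.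
clear tri h1 h2 h3 h4.
move: (nr (absop Q _ + _) ^+ 2) (nr (absop P _ + _) ^+ 2) (ain _ _ ^+ 2).
move: (nr (Q _) ^+ 2) (nr (P _) ^+ 2).
move: (nr (adjoint Q _) ^+ 2) (nr (adjoint P _) ^+ 2).
by move: (rin (absop (reop (absop Q \o _)) _) _) (rin _ _) => *; lra.
Qed.

(** Buzano's inequality for the vectors A x and adj(A) x, together with the
    arithmetic-geometric mean inequality for the product of their norms. *)
Lemma ain_offdiag_buzano (x : hsum H H) : nr x = 1 ->
  ain (A x) x ^+ 2 <= 4^-1 * E1 x + 4^-1 * E2 x +
    2^-1 * numrad (opmx (P \o Q) (\0) (\0) (Q \o P)).
Proof.
move=> x1; pose A' := opmx (\0) (adjoint Q) (adjoint P) (\0).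
have AA (y z : hsum H H) : inner (A y) z = inner y (A' z).
  rewrite /A /A' /opmx /= /hsum_inner /= !add0r !addr0.
  have [_ ->] := adjointP bP; have [_ ->] := adjointP bQ.
  by rewrite addrC.
have e1 : ain x (A' x) = ain (A x) x by rewrite /ain AA.
have e2 : ain (A x) (A' x) = ain (opmx (P \o Q) (\0) (\0) (Q \o P) x) x.
  rewrite /ain -AA; congr (complex.Re `|inner _ x|).
  by rewrite /A /opmx /= !add0r !addr0.
have bD : bounded_op (opmx (P \o Q) (\0) (\0) (Q \o P)).
  by apply: bop_opmx => //; exact: bop_comp.
have := buzano (A x) (A' x) x1; rewrite e1 e2 -expr2.
have := ain_le_numrad bD x1.
have : nr (A x) ^+ 2 = E1 x by rewrite nr_hsum /A /opmx /= add0r addr0 addrC.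
have : nr (A' x) ^+ 2 = E2 x by rewrite nr_hsum /A' /opmx /= add0r addr0 addrC.
have := sqr_ge0 (nr (A x) - nr (A' x)); rewrite sqrrB.
move: (nr (A x)) (nr (A' x)) => a b; lra.
Qed.

(** Convexity is used twice, first on the pair (a, b); both bounds on
    |<A x, x>|^2 have the shape of the argument of phi here. *)
Lemma orlicz_mix (a b c : R) : 0 <= a -> 0 <= b -> 0 <= c ->
  phi (4^-1 * a + 4^-1 * b + 2^-1 * c) <=
  4^-1 * (phi a + phi b) + 2^-1 * phi c.
Proof.
move=> a0 b00 c0.
have half : 0 <= (2^-1 : R) <= 1 by apply/andP; split; lra.
have ab : 0 <= 2^-1 * a + (1 - 2^-1) * b by lra.
have h1 := orlicz_conv ophi ab c0 half; have h2 := orlicz_conv ophi a0 b00 half.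
rewrite (_ : _ + _ = 2^-1 * (2^-1 * a + (1 - 2^-1) * b) + (1 - 2^-1) * c);
  last by field.
lra.
Qed.

Let D1 := opmx
  (cfc phi (sqop (absop Q)) \+ cfc phi (sqop (absop (adjoint P)))) (\0)
  (\0) (cfc phi (sqop (absop P)) \+ cfc phi (sqop (absop (adjoint Q)))).
Let D2 := opmx (cfc phi N1) (\0) (\0) (cfc phi N2).

Let pN1 : posop N1.
Proof.
apply: posop_absop; apply: (fun h => (reop_selfadj h).1).
exact: bop_comp (bop_absop bQ) (bop_absop bP').
Qed.

Let pN2 : posop N2.
Proof.
apply: posop_absop; apply: (fun h => (reop_selfadj h).1).
exact: bop_comp (bop_absop bP) (bop_absop bQ').
Qed.

Let pS (B : H -> H) : bounded_op B -> posop (sqop (absop B)).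
Proof. by move=> bB; exact/posop_sqop/posop_absop. Qed.

Let bphi (T : H -> H) : posop T -> bounded_op (cfc phi T).
Proof. by move=> pT; case: (selfadj_cfc_orlicz ophi pT). Qed.

Let bD1 : bounded_op D1.
Proof. by apply: bop_opmx => //; apply: bop_add; apply: bphi; exact: pS. Qed.

Let bD2 : bounded_op D2.
Proof. by apply: bop_opmx => //; exact: bphi. Qed.

Lemma orlicz_E_le (x : hsum H H) : nr x = 1 ->
  phi (E1 x) + phi (E2 x) <= opnorm D1.
Proof.
move=> x1; have x12 : nr x.1 ^+ 2 + nr x.2 ^+ 2 = 1 by rewrite -nr_hsum x1 expr1n.
apply: le_trans (rin_le_opnorm bD1 x1).
rewrite rin_hsum /D1 /opmx /= addr0 add0r !rinDl addrACA.
have := jensen2 ophi (pS bQ) (pS bP) x12; have := jensen2 ophi (pS bP') (pS bQ') x12.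
rewrite (rin_sqop_absop _ bQ) (rin_sqop_absop _ bP).
rewrite (rin_sqop_absop _ bP') (rin_sqop_absop _ bQ') => h2 h1.
exact: lerD h1 h2.
Qed.

Lemma orlicz_F_le (x : hsum H H) : nr x = 1 -> phi (F x) <= opnorm D2.
Proof.
move=> x1; have x12 : nr x.1 ^+ 2 + nr x.2 ^+ 2 = 1 by rewrite -nr_hsum x1 expr1n.
apply: le_trans (rin_le_opnorm bD2 x1).
rewrite rin_hsum /D2 /opmx /= addr0 add0r.
exact: jensen2.
Qed.

Lemma orlicz_ain_le (alpha : R) (x : hsum H H) : 0 <= alpha <= 1 -> nr x = 1 ->
  phi (ain (A x) x ^+ 2) <= 4^-1 * opnorm D1 + alpha / 2 * opnorm D2
    + (1 - alpha) / 2 * phi (numrad (opmx (P \o Q) (\0) (\0) (Q \o P))).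
Proof.
move=> /andP[al0 al1] x1.
have hE := orlicz_E_le x1; have hF := orlicz_F_le x1.
have E10 : 0 <= E1 x by rewrite addr_ge0 ?sqr_ge0.
have E20 : 0 <= E2 x by rewrite addr_ge0 ?sqr_ge0.
have F0 : 0 <= F x := addr_ge0 (pN1.2 _) (pN2.2 _).
have bD : bounded_op (opmx (P \o Q) (\0) (\0) (Q \o P)).
  by apply: bop_opmx => //; exact: bop_comp.
have w0 := numrad_ge0 bD.
have h1 := orlicz_mono ophi (sqr_ge0 _) (ain_offdiag_le x1).
have h2 := orlicz_mono ophi (sqr_ge0 _) (ain_offdiag_buzano x1).
have h3 := le_trans h1 (orlicz_mix E10 E20 F0).
have h4 := le_trans h2 (orlicz_mix E10 E20 w0).
move: h3 h4 hE hF; move: (phi (E1 x)) (phi (E2 x)) (phi (F x)) (opnorm D1) (opnorm D2).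
move: (phi (numrad _)) (phi (_ ^+ 2)) => w a e1 e2 f d1 d2 h3 h4 hE hF.
have al1' : 0 <= 1 - alpha by rewrite subr_ge0.
have h3' : a <= 4^-1 * d1 + 2^-1 * d2 by lra.
have h4' : a <= 4^-1 * d1 + 2^-1 * w by lra.
have := ler_wpM2l al0 h3'; have := ler_wpM2l al1' h4'; lra.
Qed.

Lemma numrad_bound_ge0 (alpha : R) : 0 <= alpha <= 1 ->
  0 <= 4^-1 * opnorm D1 + alpha / 2 * opnorm D2
    + (1 - alpha) / 2 * phi (numrad (opmx (P \o Q) (\0) (\0) (Q \o P))).
Proof.
move=> /andP[al0 al1].
have bD : bounded_op (opmx (P \o Q) (\0) (\0) (Q \o P)).
  by apply: bop_opmx => //; exact: bop_comp.
have w0 := orlicz_ge0 ophi (numrad_ge0 bD).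
have d1 := opnorm_ge0 bD1; have d2 := opnorm_ge0 bD2.
have al1' : 0 <= 1 - alpha by rewrite subr_ge0.
by apply: addr_ge0; [apply: addr_ge0|]; apply: mulr_ge0 => //; lra.
Qed.

End Main.

Theorem theorem4p1 (R : realType) (H : hilbertType R) (sepH : separable H)
    (P Q : H -> H) (boundedP : bounded_op P) (boundedQ : bounded_op Q)
    (phi : R -> R) (orlicz_phi : orlicz phi)
    (alpha : R) (alpha01 : 0 <= alpha <= 1) :
  phi (numrad (opmx (\0) P Q (\0)) ^+ 2) <=
    4^-1 * opnorm (opmx
      (cfc phi (sqop (absop Q)) \+ cfc phi (sqop (absop (adjoint P)))) (\0)
      (\0) (cfc phi (sqop (absop P)) \+ cfc phi (sqop (absop (adjoint Q)))))
    + alpha / 2 * opnorm (opmx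
        (cfc phi (absop (reop (absop Q \o absop (adjoint P))))) (\0)
        (\0) (cfc phi (absop (reop (absop P \o absop (adjoint Q))))))
    + (1 - alpha) / 2 * phi (numrad (opmx (P \o Q) (\0) (\0) (Q \o P))).
Proof.
have b0 := @bop_null R H H.
set A := opmx (\0) P Q (\0).
have bA : bounded_op A by exact: bop_opmx.
set D1 := opmx _ _ _ _; set D2 := opmx _ _ _ _; set W := opmx _ _ _ _.
have key := @orlicz_ain_le R H P Q boundedP boundedQ phi orlicz_phi alpha _ alpha01.
have := numrad_bound_ge0 boundedP boundedQ orlicz_phi alpha01.
move: key; rewrite -/A -/D1 -/D2 -/W; set B := _ + _ + _; move: B => B key B0.
have w0 := numrad_ge0 bA.
(* The bound for unit vectors passes to the supremum because phi is Lipschitz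
   on [0, w^2]. *)
have [->|happ] := numrad_approx bA; first by rewrite expr0n (orlicz_0 orlicz_phi).
set w := numrad A in w0 happ *.
have L0 : 0 <= phi (w ^+ 2 + 1) by apply: (orlicz_ge0 orlicz_phi); have := sqr_ge0 w; lra.
apply: (@le_of_eps _ _ _ (phi (w ^+ 2 + 1) * (2 * w))) => [|e e0].
  by rewrite !mulr_ge0.
have [x x1 wx] := happ e e0; have xw := ain_le_numrad bA x1.
have hx := key x x1; move: wx xw hx; rewrite -/w; have := ain_ge0 (A x) x.
move: (ain (A x) x) => a a0 wa aw hx.
have aw2 : a ^+ 2 <= w ^+ 2 by rewrite lerXn2r ?nnegrE.
have h := orlicz_lipschitz orlicz_phi (sqr_ge0 a) aw2 (lexx _).
have h2 : w ^+ 2 - a ^+ 2 <= 2 * w * e.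
  rewrite subr_sqr mulrC; apply: ler_pM; lra.
have := ler_wpM2l L0 h2; lra.
Qed.
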